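(* Let $n\ge 1$ be an integer and let $(\tilde X,E)$ be the minimal resolution of the germ $(X,x)$ of an $A_n$ singularity. For integers $m\ge 0$ set $$\hslash^0(A_n,m)=\dim\left[H^0(\tilde X\setminus E,S^m\Omega^1_{\tilde X})\,/\,H^0(\tilde X,S^m\Omega^1_{\tilde X})\right].$$ Then the following holds. (a) $\hslash^0(A_n,m)$ is given by a weighted lattice sum over a polygon $\mathcal P_n(m)\subset\mathbb R^2$: $$\hslash^0(A_n,m)=\sum_{\substack{\mathbf x=(x_1,x_2)\in\mathcal P_n(m)\cap\mathbb Z^2\\ x_1+(n+1)x_2\equiv m \bmod 2}}h_{n,m}(\mathbf x),$$ where (i) the polygon $\mathcal P_n(m)$ is symmetric about the $x_1$-axis, and $\mathcal P_n(m)\cap\{x_2\ge 0\}$ is given by the inequalities $-x_1\le 0$, $-x_2\le 0$, $x_1-(n-1)x_2\le m$ and $-x_1+(n+1)x_2\le m+2$; (ii) the weight function is $h_{n,m}(\mathbf x)=\min\left\{\sum_{r=0}^{n-1}\alpha_{n,m,r}(\mathbf x),\ \beta_{n,m}(\mathbf x)\right\}$, with $$\alpha_{n,m,r}(\mathbf x)=\max\left\{0,\frac{m-x_1+(2r-n+1)x_2}{2}\right\}\quad(r\in\{-1,0,\dots,n\}),$$ $$\beta_{n,m}(\mathbf x)=\max\left\{0,\ m+1-\alpha_{n,m,-1}(\mathbf x)-\alpha_{n,m,n}(\mathbf x)\right\}.$$ (b) For fixed $n$, $\hslash^0(A_n,m)=\hslash^0_\Omega(A_n)\,m^3+3\,\hslash^0_\Omega(A_n)\,m^2+O(m)$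 as $m\to\infty$, with $$\hslash^0_\Omega(A_n):=\lim_{m\to\infty}\frac{\hslash^0(A_n,m)}{m^3}=\frac43\sum_{j=1}^n\frac1{j^2}-\frac{12n^4+65n^3+117n^2+72n}{6(n+1)^2(n+2)^2}.$$
   Context: Everything is over $\mathbb C$. The $A_n$ singularity is the germ at the origin of the surface $X=\{xz-y^{n+1}=0\}\subset\mathbb C^3$; equivalently, $X=\mathbb C^2/\mathbb Z_{n+1}$ where a generator acts by $(z_1,z_2)\mapsto(\epsilon z_1,\epsilon^n z_2)$ with $\epsilon$ a primitive $(n+1)$-th root of unity, the quotient map being $(z_1,z_2)\mapsto(z_1^{n+1},z_1z_2,z_2^{n+1})$. $\sigma:\tilde X\to X$ denotes the minimal resolution and $E=E_1+\dots+E_n$ its exceptional locus (a chain of $n$ smooth rational $(-2)$-curves). $S^m\Omega^1_{\tilde X}$ is the $m$-th symmetric power of the cotangent bundle. The paper computes $\hslash^0(A_n,m)$ using the affine model $X$ above and its minimal resolution $\tilde X$. *)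

(* Defs.v *)
From HB Require Import structures.
From mathcomp Require Import all_boot all_order all_algebra.
From mathcomp Require Import fraction polyXY complex.
From mathcomp Require Import all_classical all_reals all_analysis.
Import Order.TTheory GRing.Theory Num.Theory.
Import numFieldNormedType.Exports.

Set Implicit Arguments.
Unset Strict Implicit.
Unset Printing Implicit Defensive.

Local Open Scope classical_set_scope.
Local Open Scope ring_scope.

(* X is the affine surface xz = y^(n+1) over C = complex R. Its function field
   K is C(x, y), with z = y^(n+1) / x. The outer variable of
   {poly {poly C}} is x, the inner one is y. *)
Notation CC R := (complex R) (only parsing).
Notation funK R := {fraction {poly {poly (complex R)}}}.

Definition cstK (R : realType) (c : CC R) : funK R := tofrac c%:P%:P.
Definition xK (R : realType) : funK R := tofrac ('X : {poly {poly (CC R)}}).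
Definition yK (R : realType) : funK R := tofrac ('Y : {poly {poly (CC R)}}).
Definition zK (R : realType) (n : nat) : funK R := yK R ^+ n.+1 / xK R.

(* The derivation of the fraction field of A extending a derivation D of A,
   by the quotient rule. *)
Definition frac_deriv (A : idomainType) (D : A -> A) (f : {fraction A}) :
    {fraction A} :=
  let p := (fraction.frac (repr f)).1 in let q := (fraction.frac (repr f)).2 in
  tofrac (D p * q - p * D q) / tofrac q ^+ 2.

(* The symmetric algebra over K of the Kaehler differentials
   Omega_{K/C} = K dx + K dy is the polynomial ring K[dx, dy]. *)
Notation symK R := {poly {poly (funK R)}}.

Definition inSym (R : realType) (f : funK R) : symK R := f%:P%:P.
Definition dx (R : realType) : symK R := 'X.
Definition dy (R : realType) : symK R := 'Y.
Definition dK (R : realType) (f : funK R) : symK R :=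
  inSym (frac_deriv (@deriv {poly (CC R)}) f) * dx R
  + inSym (frac_deriv (map_poly (@deriv (CC R))) f) * dy R.

(* The minimal resolution of X is the toric surface glued along open subsets
   from the affine planes U_i = Spec C[u_i, v_i], 0 <= i <= n, where
   u_i = y^(i+1) / x and v_i = x / y^i. The map sigma to X is given on U_i by
   x = u^i v^(i+1), y = u v, z = u^(n+1-i) v^(n-i), and the transition
   from U_i to U_(i+1) is u_(i+1) = u_i^2 v_i, v_(i+1) = u_i^-1
   (chart_formulas). Hence E is the chain of the n projective lines
   {v_(i-1) = 0} U {u_i = 0}, 1 <= i <= n, each of self-intersection -2. *)
Definition chartu (R : realType) (i : nat) : funK R := yK R ^+ i.+1 / xK R.
Definition chartv (R : realType) (i : nat) : funK R := xK R / yK R ^+ i.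

Fact chart_formulas (F : fieldType) (x y : F) (n i : nat) :
    x != 0 -> y != 0 -> (i <= n)%N ->
  let u k := y ^+ k.+1 / x in let v k := x / y ^+ k in
  [/\ x = u i ^+ i * v i ^+ i.+1, y = u i * v i,
      y ^+ n.+1 / x = u i ^+ (n.+1 - i) * v i ^+ (n - i),
      u i.+1 = u i ^+ 2 * v i & v i.+1 = (u i)^-1].
Proof.
move=> x0 y0 hi u v; have yi0 : y ^+ i != 0 by rewrite expf_neq0.
have uvE : u i * v i = y by rewrite /u /v mulrA mulfVK // exprS mulfK.
have powE (a b : F) k : a ^+ k * b ^+ k.+1 = (a * b) ^+ k * b.
  by rewrite [b ^+ k.+1]exprSr exprMn mulrA.
split; last by rewrite /u invf_div.
- by rewrite powE uvE /v mulrC mulfVK.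
- by rewrite uvE.
- by rewrite subSn // [RHS]mulrC powE [v i * _]mulrC uvE /u mulrA -exprD
     addnS subnK.
- by rewrite expr2 -mulrA uvE mulrC /u mulrA -exprS.
Qed.

Definition chart_fun (R : realType) (i : nat) (a : {poly {poly (CC R)}}) :
    funK R :=
  (map_poly (map_poly (@cstK R)) a).[chartu R i, chartv R i].

(* H^0(U_i, S^m Omega^1), the free C[u_i, v_i]-module on the
   du_i^(m-k) dv_i^k, as a subset of the rational symmetric differentials. *)
Definition sym_chart (R : realType) (i m : nat) : set (symK R) :=
  [set w | exists a : 'I_m.+1 -> {poly {poly (CC R)}},
     w = \sum_(k < m.+1) inSym (chart_fun i (a k))
           * (dK (chartu R i) ^+ (m - k) * dK (chartv R i) ^+ k)].

(* H^0(U_i \ {f = 0}, S^m Omega^1) for f in C[u_i, v_i], f <> 0. *)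
Definition sym_chart_loc (R : realType) (i m : nat) (f : funK R) :
    set (symK R) :=
  [set w | exists N : nat, sym_chart i m (inSym (f ^+ N) * w)].

Definition H0_res (R : realType) (n m : nat) : set (symK R) :=
  [set w | forall i : 'I_n.+1, sym_chart i m w].

(* E is the fibre of sigma over the origin, so that its complement in U_i is
   the union of the principal open subsets x <> 0, y <> 0 and z <> 0. *)
Definition H0_res_minusE (R : realType) (n m : nat) : set (symK R) :=
  [set w | forall i : 'I_n.+1,
     [/\ sym_chart_loc i m (xK R) w,
         sym_chart_loc i m (yK R) w &
         sym_chart_loc i m (zK R n) w]].

(* The classes of b_0, ..., b_(d-1) form a C-basis of W / V. *)
Definition is_basis_mod (R : realType) (W V : set (symK R)) (d : nat)
    (b : 'I_d -> symK R) : Prop :=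
  (forall j, W (b j)) /\
  forall w, W w -> exists! c : 'rV[CC R]_d,
    V (w - \sum_(j < d) inSym (cstK (c 0 j)) * b j).

Definition is_dim_quot (R : realType) (W V : set (symK R)) (d : nat) : Prop :=
  exists b : 'I_d -> symK R, is_basis_mod W V b.

Definition is_hbar0 (R : realType) (n m d : nat) : Prop :=
  is_dim_quot (@H0_res_minusE R n m) (@H0_res R n m) d.

(* Meaningful only when the quotient is finite-dimensional, that is when
   is_hbar0 R n m (hbar0 R n m) holds. *)
Definition hbar0 (R : realType) (n m : nat) : nat :=
  xget 0%N [set d | is_hbar0 R n m d].

Definition upper_polygon (R : realType) (n m : nat) : set (R * R) :=
  [set x | [/\ - x.1 <= 0, - x.2 <= 0,
               x.1 - (n%:R - 1) * x.2 <= m%:R &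
               - x.1 + (n%:R + 1) * x.2 <= m%:R + 2]].

Definition polygon (R : realType) (n m : nat) : set (R * R) :=
  [set x | upper_polygon n m x \/ upper_polygon n m (x.1, - x.2)].

Definition alpha (R : realType) (n m : nat) (r : int) (x : R * R) : R :=
  Num.max 0 ((m%:R - x.1 + (2 * r%:~R - n%:R + 1) * x.2) / 2).

Definition beta (R : realType) (n m : nat) (x : R * R) : R :=
  Num.max 0 (m%:R + 1 - alpha n m (-1) x - alpha n m n%:Z x).

Definition weight (R : realType) (n m : nat) (x : R * R) : R :=
  Num.min (\sum_(r < n) alpha n m r%:Z x) (beta n m x).

Definition int_point (R : realType) (x : int * int) : R * R :=
  (x.1%:~R, x.2%:~R).

Definition lattice_points (R : realType) (n m : nat) : set (int * int) :=
  [set x | polygon n m (int_point R x) /\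
           (x.1 + n.+1%:Z * x.2 = m%:Z %[mod 2])%Z].

Definition hbarOmega (R : realType) (n : nat) : R :=
  lim ((fun m : nat => (hbar0 R n m)%:R / m%:R ^+ 3 : R) @ \oo).

(* Main.v *)
Require Import Defs.
From HB Require Import structures.
From mathcomp Require Import all_boot all_order all_algebra.
From mathcomp Require Import fraction polyXY complex generic_quotient.
From mathcomp Require Import all_classical all_reals all_analysis.
From mathcomp Require Import zify ring lra.
Import Order.TTheory GRing.Theory Num.Theory.
Import numFieldNormedType.Exports.

Set Implicit Arguments.
Unset Strict Implicit.
Unset Printing Implicit Defensive.

Local Open Scope classical_set_scope.
Local Open Scope ring_scope.

(* The minimal resolution is toric: on the torus x y <> 0 a symmetric
   differential of degree m is a finite sum of characters chi = x^a y^b times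
   forms of degree m in dx/x and dy/y. The boundary divisors D_0, ..., D_(n+1)
   belong to the rays (i, 1), so that chi has order k_i = i a + b along D_i, and
   the chi-component is regular along D_i if and only if its form is divisible by
   (dx/x - i dy/y)^e_i with e_i = max(0, m - k_i). Off E only D_0 and D_(n+1)
   remain. As the n + 2 linear forms are pairwise coprime, the chi-component of
   the quotient has dimension min(e_1 + ... + e_n, m + 1 - e_0 - e_(n+1)), which is
   the weight at x = (2 b - m + (n + 1) a, - a).
   For the growth, put M = m + 1 and c = m - b, so that e_i = max(0, c - i a).
   With g_0 = e_0 + e_(n+1) and g = e_0 + ... + e_(n+1) the weight is
   max(0, M - g_0) - max(0, M - g); both g_0 and g are linear on the unimodular
   cones spanned by consecutive rays of the fan (1, 1), ..., (1, n + 1), (0, 1) and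
   on their images under (a, c) -> (- a, c - (n + 1) a). On a cone where g has the
   values A and B at the two generators the sum is
   M^3 / (6 A B) + M^2 / 4 (1 / A - 1 / B) + O(M), and the terms in M^2 telescope
   to zero, which leaves a constant times M^3 = (m + 1)^3 up to O(m). *)

(** * Laurent expansions of symmetric differentials *)

(* A pair [chi = (a, b)] stands for the character x^a y^b. *)
Definition ray_ord (i : nat) (chi : int * int) : int := i%:Z * chi.1 + chi.2.

(** The exponent e_i. The argument of the absolute value is nonnegative, so that [absz] only
    converts it to a natural number. *)
Definition defect (m i : nat) (chi : int * int) : nat :=
  `|Num.max 0%R (m%:Z - ray_ord i chi)%R|%N.

(** The dimension of the chi-component of the quotient. Truncated subtraction plays the role of the
    maximum with 0 in [beta]. *)
Definition jump (m n : nat) (chi : int * int) : nat :=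
  minn (\sum_(1 <= i < n.+1) defect m i chi)
       (m.+1 - (defect m 0 chi + defect m n.+1 chi)).

Lemma ray_ordD i chi1 chi2 : ray_ord i (chi1 + chi2) = ray_ord i chi1 + ray_ord i chi2.
Proof. by rewrite /ray_ord /=; lia. Qed.

Lemma ray_ordMn i chi N : ray_ord i (chi *+ N) = ray_ord i chi *+ N.
Proof.
elim: N => [|N IH]; first by rewrite !mulr0n /ray_ord /=; lia.
by rewrite !mulrS ray_ordD IH.
Qed.

Lemma defectP m i chi : m%:Z <= ray_ord i chi + (defect m i chi)%:Z.
Proof. by rewrite /defect; lia. Qed.

Section LaurentForms.

Variables (C K : fieldType) (cst : {rmorphism C -> K}) (x y : K).
Hypotheses (x0 : x != 0) (y0 : y != 0).
Hypothesis xy_free : forall p : {poly {poly C}},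
  (map_poly (map_poly cst) p).[x, y] = 0 -> p = 0.

Local Notation S := {poly {poly K}}.

Definition const2 : K -> S := polyC \o polyC.
HB.instance Definition _ := GRing.RMorphism.on const2.

Definition mon (chi : int * int) : K := x ^ chi.1 * y ^ chi.2.

Lemma monD chi1 chi2 : mon (chi1 + chi2) = mon chi1 * mon chi2.
Proof. by rewrite /mon !expfzDr // mulrACA. Qed.

Lemma mon0 : mon 0 = 1.
Proof. by rewrite /mon !expr0z mulr1. Qed.

Lemma monX chi N : mon (chi *+ N) = mon chi ^+ N.
Proof.
by elim: N => [|N IH]; rewrite ?mulr0n ?mon0 // mulrSr monD IH exprSr.
Qed.

Lemma const2_monD chi1 chi2 : const2 (mon (chi1 + chi2)) = const2 (mon chi1) * const2 (mon chi2).
Proof. by rewrite monD [LHS]rmorphM. Qed.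

(* [logx] is dx/x and [logy] is dy/y; [lform i] is the logarithmic differential of
   [chartv i], and [- lform i.+1] that of [chartu i]. *)
Definition logx : S := const2 x^-1 * 'X.
Definition logy : S := const2 y^-1 * 'Y.
Definition lform (i : nat) : S := logx - logy *+ i.

(* The homogenization of [f] to degree [m], which turns [('X - i) * _] into
   multiplication by [lform i]; faithful only on [size f <= m.+1]. *)
Definition theta m (f : {poly C}) : S :=
  \sum_(j < m.+1) const2 (cst f`_j) * (logx ^+ j * logy ^+ (m - j)).

Lemma theta_linear m c f g :
  theta m (f + c *: g) = theta m f + const2 (cst c) * theta m g.
Proof.
rewrite /theta mulr_sumr -big_split; apply: eq_bigr => j _ /=.
by rewrite coefD coefZ !rmorphD !rmorphM /=; ring.
Qed.

Lemma theta0 m : theta m 0 = 0.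
Proof. by rewrite /theta big1 // => j _; rewrite coef0 !rmorph0 mul0r. Qed.

Lemma thetaZ m c f : theta m (c *: f) = const2 (cst c) * theta m f.
Proof. by rewrite -[c *: f]add0r theta_linear theta0 add0r. Qed.

Lemma thetaD m f g : theta m (f + g) = theta m f + theta m g.
Proof. by rewrite -[g in LHS]scale1r theta_linear !rmorph1 mul1r. Qed.

Lemma theta_sum m (I : Type) (r : seq I) (F : I -> {poly C}) :
  theta m (\sum_(i <- r) F i) = \sum_(i <- r) theta m (F i).
Proof.
by elim: r => [|i r IH]; rewrite ?big_nil ?theta0 // !big_cons thetaD IH.
Qed.

(** The factor 'X shifts the coefficients and gives [logx]; the constant i raises each power of
    [logy]. By the size bound f has no coefficient in degree m + 1, the one term that cannot take
    another [logy]. *)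
Lemma theta_lform m i (f : {poly C}) : (size f <= m.+1)%N ->
  theta m.+1 (('X - i%:R%:P) * f) = lform i * theta m f.
Proof.
move=> sf; rewrite mulrBl -scaleN1r theta_linear mulrBl; congr (_ + _).
  rewrite /theta big_ord_recl coefXM /= rmorph0 rmorph0 mul0r add0r mulr_sumr.
  apply: eq_bigr => j _; rewrite coefXM /= subSS exprS; ring.
rewrite [_ * f]mul_polyC thetaZ !rmorph_nat.
rewrite !rmorphN1 mulN1r; congr (- _).
rewrite -[logy *+ i]mulr_natl -mulrA; congr (_ * _).
rewrite /theta big_ord_recr /= nth_default // !rmorph0 mul0r addr0 mulr_sumr.
by apply: eq_bigr => j _; rewrite (subSn (ltnSE (ltn_ord j))) exprS; ring.
Qed.

Lemma theta1 : theta 0 1 = 1.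
Proof. by rewrite /theta big_ord1 coef1 !rmorph1 !expr0 !mulr1. Qed.

Lemma size_lin2 i k l :
  size (('X - i%:R%:P) ^+ k * ('X - i.+1%:R%:P) ^+ l : {poly C}) = (k + l).+1.
Proof.
rewrite size_mul ?expf_neq0 ?polyXsubC_eq0 // !size_exp_XsubC; lia.
Qed.

Lemma theta_lin2 i k l :
  theta (k + l) (('X - i%:R%:P) ^+ k * ('X - i.+1%:R%:P) ^+ l) =
  lform i ^+ k * lform i.+1 ^+ l.
Proof.
elim: k => [|k IH]; last first.
  by rewrite addSn exprS -mulrA theta_lform ?size_lin2 // IH mulrA exprS.
rewrite !expr0 !mul1r; elim: l => [|l IH]; first by rewrite expr0 theta1.
by rewrite add0n exprS theta_lform ?size_exp_XsubC // -[l in theta l]add0n IH exprS.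
Qed.

Lemma theta_lin2_sub i k m : (k <= m)%N ->
  theta m (('X - i%:R%:P) ^+ k * ('X - i.+1%:R%:P) ^+ (m - k)) =
  lform i ^+ k * lform i.+1 ^+ (m - k).
Proof. by move/subnKC => {1}<-; exact: theta_lin2. Qed.

(** These products correspond to the generators du_i^(d-k) dv_i^k. Removing a multiple of the k = 0
    product makes i a root of g, and division by 'X - i lowers the degree. *)
Lemma expand_lin2 i d (g : {poly C}) : (size g <= d.+1)%N ->
  exists c : nat -> C, g =
    \sum_(k < d.+1) c k *: (('X - i%:R%:P) ^+ k * ('X - i.+1%:R%:P) ^+ (d - k)).
Proof.
elim: d g => [|d IH] g sg.
  exists (fun=> g`_0); rewrite big_ord1 /= !expr0 mulr1 alg_polyC.
  exact: size1_polyC.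
set b : {poly C} := ('X - i.+1%:R%:P) ^+ d.+1.
have bi : b.[i%:R] = (-1) ^+ d.+1.
  by rewrite /b horner_exp hornerXsubC -natr1 opprD addrA subrr add0r.
(* The sign is its own inverse, so this is g(i) / b(i). *)
pose a := g.[i%:R] * (-1) ^+ d.+1.
have /factor_theorem[q gq] : root (g - a *: b) i%:R.
  rewrite /root hornerD hornerN hornerZ bi /a -mulrA -exprMn mulrNN mul1r expr1n mulr1.
  by rewrite subrr.
have sq : (size q <= d.+1)%N.
  have [->|q0] := eqVneq q 0; first by rewrite size_poly0.
  have: (size (g - a *: b)%R <= d.+2)%N.
    rewrite (leq_trans (size_polyD _ _)) // geq_max sg size_polyN.
    by rewrite (leq_trans (size_scale_leq _ _)) // size_exp_XsubC.
  by rewrite gq size_Mmonic ?monicXsubC // size_XsubC addn2.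
have [c qc] := IH q sq.
exists (fun k => if k is k'.+1 then c k' else a).
rewrite big_ord_recl /= expr0 mul1r subn0 -/b.
rewrite -[g in LHS](subrK (a *: b)) addrC gq qc mulr_suml; congr (_ + _).
apply: eq_bigr => k _; rewrite /= subSS exprS -scalerAl; congr (_ *: _).
by ring.
Qed.

(** * Expansions into characters and their uniqueness *)

Lemma eq_big_support (T : eqType) (V : nmodType) (s t : seq T) (G : T -> V) :
  uniq s -> uniq t -> (forall z, z \notin s -> G z = 0) ->
  (forall z, z \notin t -> G z = 0) ->
  \sum_(z <- s) G z = \sum_(z <- t) G z.
Proof.
move=> us ut Gs Gt.
have supp r : \sum_(z <- r) G z = \sum_(z <- [seq z <- r | G z != 0]) G z.
  rewrite (bigID (fun z => G z == 0)) /= big1 ?add0r ?big_filter //.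
  by move=> z /eqP.
rewrite supp [RHS]supp; apply: perm_big; apply: uniq_perm.
- exact: filter_uniq.
- exact: filter_uniq.
move=> z; rewrite !mem_filter; case: eqVneq => //= Gz.
have [//|/Gs/eqP] := boolP (z \in s); last by rewrite (negPf Gz).
by have [//|/Gt/eqP] := boolP (z \in t); rewrite (negPf Gz).
Qed.

(** The list has only to contain the support of [F], so that two expansions can be compared over a
    common list by [expandsE]. *)
Definition expands m (w : S) (F : int * int -> {poly C}) : Prop :=
  exists2 s : seq (int * int), forall chi, chi \notin s -> F chi = 0 &
    w = \sum_(chi <- undup s) const2 (mon chi) * theta m (F chi).

Lemma expandsE m w F (s : seq (int * int)) : expands m w F -> uniq s ->
    (forall chi, chi \notin s -> F chi = 0) ->
  w = \sum_(chi <- s) const2 (mon chi) * theta m (F chi).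
Proof.
move=> [t Ft ->] us Fs; apply: eq_big_support => //; first exact: undup_uniq.
  by move=> z; rewrite mem_undup => /Ft ->; rewrite theta0 mulr0.
by move=> z /Fs ->; rewrite theta0 mulr0.
Qed.

Lemma expands_linear m c w1 w2 F1 F2 : expands m w1 F1 -> expands m w2 F2 ->
  expands m (w1 + const2 (cst c) * w2) (fun chi => F1 chi + c *: F2 chi).
Proof.
move=> E1 E2; case: (E1) (E2) => [s1 Fs1 _] [s2 Fs2 _].
pose s := undup (s1 ++ s2).
have Fs chi : chi \notin s -> F1 chi = 0 /\ F2 chi = 0.
  by rewrite mem_undup mem_cat negb_or => /andP[/Fs1 -> /Fs2 ->].
exists s => [chi /Fs[-> ->]|]; first by rewrite scaler0 addr0.
rewrite undup_id ?undup_uniq //.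
rewrite (expandsE E1 (undup_uniq (s1 ++ s2))) => [|chi /Fs[]//].
rewrite (expandsE E2 (undup_uniq (s1 ++ s2))) => [|chi /Fs[]//].
rewrite mulr_sumr -big_split; apply: eq_bigr => chi _ /=.
by rewrite theta_linear mulrDr mulrCA.
Qed.

Lemma expands0 m : expands m 0 (fun=> 0).
Proof. by exists nil; rewrite ?big_nil. Qed.

Lemma expands_mon m chi0 (f : {poly C}) :
  expands m (const2 (mon chi0) * theta m f) (fun chi => if chi == chi0 then f else 0).
Proof.
exists [:: chi0] => [chi|]; first by rewrite inE => /negPf ->.
by rewrite /= big_seq1 eqxx.
Qed.

Lemma expands_shift m chi0 w F : expands m w F ->
  expands m (const2 (mon chi0) * w) (fun chi => F (chi - chi0)).
Proof.
move=> E; case: (E) => s Fs _; have /= shI := @addIr _ chi0.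
exists (map (+%R^~ chi0) s) => [chi chis|].
  apply: Fs; apply: contra chis => chis; apply/mapP.
  by exists (chi - chi0); rewrite ?subrK.
rewrite undup_map_inj //= big_map (expandsE E (undup_uniq s)); last first.
  by move=> chi; rewrite mem_undup => /Fs.
rewrite mulr_sumr; apply: eq_bigr => chi _.
rewrite addrK const2_monD; ring.
Qed.

Lemma coef_const2XY f a b j l : (const2 f * ('Y ^+ a * 'X^b))`_j`_l = f *+ ((j == b) && (l == a)).
Proof.
rewrite /const2 /= -rmorphXn /= !coefCM coefXn.
by case: eqP => _; rewrite ?mulr1 ?coefXn ?mulr0 ?coef0 ?mulr0 //=; case: eqP; rewrite ?mulr1 ?mulr0.
Qed.

(** Each dx^j dy^(m-j) has as coefficient a linear relation between characters. Multiplied by a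
    power of x y it becomes a polynomial relation between x and y, which is trivial by [xy_free]. *)
Lemma expands_inj0 m F : expands m 0 F -> (forall chi, size (F chi) <= m.+1)%N ->
  forall chi, F chi = 0.
Proof.
move=> [s Fs E] sF.
have coef0F j : (j <= m)%N -> \sum_(chi <- undup s) mon chi * cst (F chi)`_j = 0.
  move=> jm.
  have: (\sum_(chi <- undup s) const2 (mon chi) * theta m (F chi))`_j`_(m - j) = 0.
    by rewrite -E !coef0.
  have termE chi : (const2 (mon chi) * theta m (F chi))`_j`_(m - j) =
      mon chi * cst (F chi)`_j * (x^-1 ^+ j * y^-1 ^+ (m - j)).
    have monE k : const2 (mon chi) * (const2 (cst (F chi)`_k) * (logx ^+ k * logy ^+ (m - k)))
        = const2 (mon chi * cst (F chi)`_k * (x^-1 ^+ k * y^-1 ^+ (m - k))) *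
          ('Y ^+ (m - k) * 'X^k).
      by rewrite /logx /logy !exprMn -!(rmorphXn const2) !(rmorphM const2) /=; ring.
    rewrite /theta mulr_sumr coef_sum coef_sum (bigD1 (Ordinal (jm : (j < m.+1)%N))) //=.
    rewrite monE coef_const2XY !eqxx mulr1n big1 ?addr0 // => i ij.
    by rewrite monE coef_const2XY [j == i]eq_sym (negPf (ij : (i != j :> nat))).
  rewrite !coef_sum; under eq_bigr do rewrite termE.
  rewrite -mulr_suml => /eqP; rewrite mulf_eq0 orbC.
  by rewrite mulf_eq0 !expf_eq0 !invr_eq0 (negPf x0) (negPf y0) !andbF /= => /eqP.
(* N bounds all exponents in absolute value, so that multiplication by (x y)^N leaves only
   nonnegative ones. *)
pose N := \max_(chi <- s) (`|chi.1| + `|chi.2|)%N.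
have Nb chi : chi \in s -> (`|chi.1| + `|chi.2| <= N)%N.
  by move=> cs; rewrite /N (leq_bigmax_seq (F := fun chi : int * int => (`|chi.1| + `|chi.2|)%N)).
move=> chi0; have [chi0s|/Fs//] := boolP (chi0 \in s).
apply/polyP => j; rewrite coef0.
have [jm|mj] := leqP j m; last by rewrite nth_default // (leq_trans (sF _)).
pose e1 (chi : int * int) := `|(chi.1 + N%:Z)%R|%N.
pose e2 (chi : int * int) := `|(chi.2 + N%:Z)%R|%N.
have e1E chi : chi \in s -> (e1 chi)%:Z = chi.1 + N%:Z.
  by move/Nb; rewrite /e1; move: (N) chi => M [a b] /=; lia.
have e2E chi : chi \in s -> (e2 chi)%:Z = chi.2 + N%:Z.
  by move/Nb; rewrite /e2; move: (N) chi => M [a b] /=; lia.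
pose p : {poly {poly C}} :=
  \sum_(chi <- undup s) ((F chi)`_j *: 'X^(e2 chi))%:P * 'X^(e1 chi).
have p0 : p = 0.
  apply: xy_free; rewrite /p rmorph_sum /= !horner_sum.
  transitivity ((\sum_(chi <- undup s) mon chi * cst (F chi)`_j) * mon (N%:Z, N%:Z)).
    rewrite mulr_suml [LHS]big_seq_cond [RHS]big_seq_cond.
    apply: eq_bigr => chi; rewrite andbT mem_undup => chis.
    rewrite mulrAC -monD rmorphM /= map_polyC map_polyXn !hornerE.
    rewrite [X in X.[y]]map_polyZ map_polyXn !hornerE /mon /=.
    rewrite -e1E // -e2E //.
    by rewrite -!exprnP; ring.
  by rewrite coef0F // mul0r.
have := congr1 (fun q : {poly {poly C}} => q`_(e1 chi0)`_(e2 chi0)) p0.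
rewrite !coef0 /p !coef_sum (bigD1_seq chi0) ?mem_undup ?undup_uniq //=.
rewrite big_seq_cond big1 => [|chi /andP[]]; last first.
  rewrite mem_undup => chis cc; rewrite coefCM coefXn.
  have [ee|] := eqVneq (e1 chi0) (e1 chi); last by rewrite mulr0 coef0.
  rewrite mulr1 coefZ coefXn; have [ee'|] := eqVneq (e2 chi0) (e2 chi).
    move: (e1E _ chis) (e2E _ chis); rewrite -ee -ee' e1E // e2E // => /addIr c1 /addIr c2.
    by case/eqP: cc; rewrite [chi]surjective_pairing [chi0]surjective_pairing c1 c2.
  by rewrite mulr0.
by rewrite addr0 coefCM coefXn eqxx mulr1 coefZ coefXn eqxx mulr1.
Qed.

Lemma expands_inj m w F1 F2 : expands m w F1 -> expands m w F2 ->
    (forall chi, size (F1 chi) <= m.+1)%N -> (forall chi, size (F2 chi) <= m.+1)%N ->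
  F1 =1 F2.
Proof.
move=> E1 E2 s1 s2 chi; apply/eqP; rewrite -subr_eq0 -scaleN1r; apply/eqP.
have /expands_inj0-> // : expands m 0 (fun chi => F1 chi + (-1) *: F2 chi).
  rewrite -[0](subrr w); have := expands_linear (-1) E1 E2.
  by rewrite !rmorphN1 mulN1r.
move=> {}chi; rewrite (leq_trans (size_polyD _ _)) // geq_max s1.
by rewrite (leq_trans (size_scale_leq _ _)).
Qed.

(** * Forms regular on a single toric chart *)

Definition lcoordu i : int * int := (-1, i.+1%:Z).
Definition lcoordv i : int * int := (1, - i%:Z).

Lemma monu i : mon (lcoordu i) = y ^+ i.+1 / x.
Proof. by rewrite /mon /= exprN1 mulrC. Qed.

Lemma monv i : mon (lcoordv i) = x / y ^+ i.
Proof. by rewrite /mon /= expr1z exprnN. Qed.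

(** The exponent vectors of u_i and v_i are dual to the rays (i, 1) and (i + 1, 1): in U_i the
    divisors D_i and D_(i+1) are u_i = 0 and v_i = 0. *)
Lemma lcoord_split i chi :
  chi = lcoordu i *~ ray_ord i chi + lcoordv i *~ ray_ord i.+1 chi.
Proof.
case: chi => a b; rewrite /ray_ord /lcoordu /lcoordv /=.
rewrite [RHS]surjective_pairing /= !raddfMz /=.
congr pair; rewrite !mulrzz; lia.
Qed.

(** The counterpart of [sym_chart] for abstract x and y, with du_i and dv_i written as u_i and v_i
    times their logarithmic differentials. *)
Definition chart_form i m (w : S) : Prop :=
  exists a : 'I_m.+1 -> {poly {poly C}},
    w = \sum_(k < m.+1)
      const2 ((map_poly (map_poly cst) (a k)).[mon (lcoordu i), mon (lcoordv i)]) *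
      ((const2 (mon (lcoordu i)) * - lform i.+1) ^+ (m - k) *
       (const2 (mon (lcoordv i)) * lform i) ^+ k).

Lemma horner2E (a : {poly {poly C}}) (u v : K) :
  (map_poly (map_poly cst) a).[u, v] =
  \sum_(j < size a) \sum_(l < size a`_j) cst a`_j`_l * v ^+ l * u ^+ j.
Proof.
rewrite [_.[u%:P]]horner_coef size_map_inj_poly ?rmorph0 //; last first.
  exact/map_inj_poly/rmorph0/fmorph_inj.
rewrite horner_sum; apply: eq_bigr => j _.
rewrite -rmorphXn /= hornerM hornerC coef_map horner_coef size_map_poly mulr_suml.
by apply: eq_bigr => l _; rewrite coef_map.
Qed.

Definition graded_span m (P : int * int -> {poly C} -> Prop) (w : S) : Prop :=
  exists2 F, expands m w F & forall chi, P chi (F chi).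

Definition subspaces (P : int * int -> {poly C} -> Prop) : Prop :=
  (forall chi, P chi 0) /\
  (forall chi c f g, P chi f -> P chi g -> P chi (f + c *: g)).

Lemma graded_span_linear m P c w1 w2 : subspaces P -> graded_span m P w1 -> graded_span m P w2 ->
  graded_span m P (w1 + const2 (cst c) * w2).
Proof.
move=> [_ PD] [F1 E1 P1] [F2 E2 P2].
by exists (fun chi => F1 chi + c *: F2 chi); [exact: expands_linear | auto].
Qed.

Lemma graded_span0 m P : subspaces P -> graded_span m P 0.
Proof. by move=> [P0 _]; exists (fun=> 0); [exact: expands0 |]. Qed.

Lemma graded_span_sum m P (I : Type) (r : seq I) (F : I -> S) : subspaces P ->
  (forall i, graded_span m P (F i)) -> graded_span m P (\sum_(i <- r) F i).
Proof.
move=> sP sF; elim/big_ind: _ => [|w1 w2 s1 s2|//]; first exact: graded_span0.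
by rewrite -[w2]mul1r -(rmorph1 const2) -(rmorph1 cst); apply: graded_span_linear.
Qed.

Lemma graded_span_mon m P chi f : subspaces P -> P chi f ->
  graded_span m P (const2 (mon chi) * theta m f).
Proof.
move=> [P0 _] Pf; exists (fun chi' => if chi' == chi then f else 0).
  exact: expands_mon.
by move=> chi'; case: eqP => [->|].
Qed.

Definition vanish m i chi (f : {poly C}) : bool :=
  ('X - i%:R%:P) ^+ defect m i chi %| f.

(** Regularity of the chi-component along the divisors selected by [I]. The size bound keeps [theta]
    faithful, so that divisibility can be tested on f. *)
Definition regular m (I : pred nat) chi (f : {poly C}) : Prop :=
  (size f <= m.+1)%N /\ forall i, I i -> vanish m i chi f.

Lemma regular_subspaces m I : subspaces (regular m I).
Proof.
split=> [chi|chi c f g [sf vf] [sg vg]].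
  by split=> [|i _]; rewrite ?size_poly0 // /vanish dvdp0.
split=> [|i Ii]; last first.
  by apply: dvdp_add; [exact: vf | rewrite -mul_polyC; apply/dvdp_mull/vg].
rewrite (leq_trans (size_polyD _ _)) // geq_max sf.
by rewrite (leq_trans (size_scale_leq _ _)).
Qed.

Lemma chart_form_add i m w1 w2 : chart_form i m w1 -> chart_form i m w2 ->
  chart_form i m (w1 + w2).
Proof.
move=> [a1 ->] [a2 ->]; exists (fun k => a1 k + a2 k).
rewrite -big_split; apply: eq_bigr => k _ /=.
by rewrite rmorphD !hornerD -mulrDl rmorphD.
Qed.

Lemma chart_form0 i m : chart_form i m 0.
Proof.
by exists (fun=> 0); rewrite big1 // => k _; rewrite rmorph0 !horner0 rmorph0 mul0r.
Qed.

Lemma chart_form_sum i m (I : Type) (r : seq I) (F : I -> S) :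
  (forall j, chart_form i m (F j)) -> chart_form i m (\sum_(j <- r) F j).
Proof.
move=> cF; elim/big_ind: _ => // [|w1 w2]; first exact: chart_form0.
exact: chart_form_add.
Qed.

Lemma coprime_lin i k l :
  coprimep (('X - i%:R%:P : {poly C}) ^+ k) (('X - i.+1%:R%:P) ^+ l).
Proof.
rewrite coprimep_expl // coprimep_expr // coprimep_XsubC2 //.
by rewrite -natr1 addrAC subrr add0r oner_eq0.
Qed.

(** The monomial u_i^j v_i^l du_i^(m-k) dv_i^k has a character of orders j + m - k and l + k along
    D_i and D_(i+1), hence defects at most k and m - k. Its polynomial contains exactly these powers
    of the two linear factors. *)
Lemma graded_span_chart_form i m w : chart_form i m w ->
  graded_span m (regular m (fun r => (r == i) || (r == i.+1))) w.
Proof.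
move=> [a ->]; apply: graded_span_sum => [|k]; first exact: regular_subspaces.
rewrite horner2E rmorph_sum mulr_suml; apply: graded_span_sum => [|j].
  exact: regular_subspaces.
rewrite rmorph_sum mulr_suml; apply: graded_span_sum => [|l]; first exact: regular_subspaces.
have km : (k <= m)%N by rewrite -ltnS.
set c := (a k)`_j`_l.
pose f : {poly C} := (c * (-1) ^+ (m - k)) *:
  (('X - i%:R%:P) ^+ k * ('X - i.+1%:R%:P) ^+ (m - k)).
pose chi := lcoordu i *+ (j + (m - k)) + lcoordv i *+ (l + k).
rewrite (_ : _ * _ = const2 (mon chi) * theta m f); last first.
  rewrite /chi const2_monD !monX /f thetaZ theta_lin2_sub //.
  move: (mon (lcoordu i)) (mon (lcoordv i)) => U V.
  rewrite (rmorphM cst) (rmorphXn cst) (rmorphN1 cst) !(rmorphM const2) !(rmorphXn const2) (rmorphN1 const2).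
  rewrite !exprMn !exprD [(- lform _) ^+ _]exprNn; ring.
apply: graded_span_mon; first exact: regular_subspaces.
split=> [|r]; first by rewrite (leq_trans (size_scale_leq _ _)) // size_lin2 subnKC.
have ou : ray_ord i chi = j%:Z + (m - k)%N%:Z.
  rewrite /chi ray_ordD !ray_ordMn /ray_ord /lcoordu /lcoordv /= !pmulrn !mulrzz; lia.
have ov : ray_ord i.+1 chi = l%:Z + k%:Z.
  rewrite /chi ray_ordD !ray_ordMn /ray_ord /lcoordu /lcoordv /= !pmulrn !mulrzz; lia.
rewrite /vanish /f -mul_polyC => /orP[]/eqP->; apply: dvdp_mull.
  by rewrite dvdp_mulr // dvdp_exp2l // /defect ou; lia.
by rewrite dvdp_mull // dvdp_exp2l // /defect ov; lia.
Qed.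

Lemma chart_form_mon i m chi c k : (k <= m)%N ->
  (m - k)%N%:Z <= ray_ord i chi -> k%:Z <= ray_ord i.+1 chi ->
  chart_form i m (const2 (mon chi) *
    theta m (c *: (('X - i%:R%:P) ^+ k * ('X - i.+1%:R%:P) ^+ (m - k)))).
Proof.
move=> km ou ov.
(* p and q are the exponents left to u_i and v_i once du_i^(m-k) dv_i^k has used up u_i^(m-k)
   v_i^k. *)
pose p := `|(ray_ord i chi - (m - k)%N%:Z)%R|%N.
pose q := `|(ray_ord i.+1 chi - k%:Z)%R|%N.
exists (fun k' : 'I_m.+1 => if k' == k :> nat
                  then ((c * (-1) ^+ (m - k)) *: 'X^q)%:P * 'X^p else 0).
rewrite (bigD1 (Ordinal (km : (k < m.+1)%N))) //= eqxx big1 ?addr0; last first.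
  by move=> k' /negPf nk; rewrite -val_eqE /= in nk; rewrite nk rmorph0 !horner0 rmorph0 mul0r.
have -> : chi = lcoordu i *+ (p + (m - k)) + lcoordv i *+ (q + k).
  rewrite [LHS](lcoord_split i) !pmulrn; congr (_ *~ _ + _ *~ _); rewrite /p /q; lia.
rewrite const2_monD !monX thetaZ theta_lin2_sub //.
rewrite rmorphM /= map_polyC map_polyXn !hornerE [X in X.[_]]map_polyZ map_polyXn !hornerE.
move: (mon (lcoordu i)) (mon (lcoordv i)) => U V.
rewrite !(rmorphM cst) (rmorphXn cst) (rmorphN1 cst) !(rmorphM const2) !(rmorphXn const2) (rmorphN1 const2).
rewrite !exprMn !exprD [(- lform _) ^+ _]exprNn.
(* The sign in the coefficient cancels the one in du_i = - u_i [lform i.+1]. *)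
set e := (-1 : S) ^+ (m - k).
have ee : e * e = 1 by rewrite -exprMn mulrNN mulr1 expr1n.
rewrite -[LHS]mul1r -ee /=; ring.
Qed.

(** The two required powers are coprime, so their product divides f. Expanding the cofactor by
    [expand_lin2] in degree m - e - e1 leaves terms whose exponents fit the orders of chi, as
    [chart_form_mon] demands. *)
Lemma chart_form_span i m w :
  graded_span m (regular m (fun r => (r == i) || (r == i.+1))) w -> chart_form i m w.
Proof.
move=> [F [s _ ->]] RF; apply: chart_form_sum => chi.
have [] := RF chi; move: (F chi) => f sf vf.
have := vf i; rewrite eqxx => /(_ isT) vi.
have := vf i.+1; rewrite eqxx orbT => /(_ isT) vi1.
have [->|f0] := eqVneq f 0; first by rewrite theta0 mulr0; exact: chart_form0.
move: vi vi1; rewrite /vanish; set e := defect m i chi; set e1 := defect m i.+1 chi => vi vi1.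
have /dvdpP[g fg] : ('X - i%:R%:P) ^+ e * ('X - i.+1%:R%:P) ^+ e1 %| f.
  by rewrite Gauss_dvdp ?vi ?vi1 // coprime_lin.
have g0 : g != 0 by apply: contraNneq f0 => g0; rewrite fg g0 mul0r.
have sfg : size f = (size g + (e + e1))%N.
  rewrite fg size_mul // ?size_lin2; last by rewrite -size_poly_eq0 size_lin2.
  by rewrite addnS.
pose d := (m - (e + e1))%N.
have sg : (size g <= d.+1)%N by rewrite /d; move: sf; rewrite sfg; lia.
have em : (e + e1 <= m)%N.
  by move: sf g0; rewrite sfg -size_poly_gt0; lia.
have [c gc] := expand_lin2 i sg.
rewrite fg gc mulr_suml theta_sum mulr_sumr; apply: chart_form_sum => k.
have: (k <= d)%N by rewrite -ltnS.
move: (nat_of_ord k) => {}k kd.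
have -> : c k *: (('X - i%:R%:P) ^+ k * ('X - i.+1%:R%:P) ^+ (d - k)) *
    (('X - i%:R%:P) ^+ e * ('X - i.+1%:R%:P) ^+ e1) =
    c k *: (('X - i%:R%:P) ^+ (e + k) * ('X - i.+1%:R%:P) ^+ (m - (e + k))).
  rewrite (_ : (m - (e + k) = e1 + (d - k))%N); last by rewrite /d in kd *; lia.
  by rewrite !exprD -![c k *: _]mul_polyC; ring.
have := defectP m i chi; have := defectP m i.+1 chi; rewrite -/e -/e1.
by move: kd em; rewrite /d; clearbody e e1 => kd em ? ?; apply: chart_form_mon; lia.
Qed.

(** * Gluing of the charts and localization *)

Definition chart_loc i m chi (w : S) : Prop :=
  exists N, chart_form i m (const2 (mon chi ^+ N) * w).

Definition end_rays n : pred nat := fun i => (i == 0%N) || (i == n.+1).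
Definition all_rays n : pred nat := fun i => (i <= n.+1)%N.

Lemma sub_regular m (I J : pred nat) chi f : (forall i, J i -> I i) ->
  regular m I chi f -> regular m J chi f.
Proof. by move=> JI [sf vf]; split => // i /JI/vf. Qed.

(** By uniqueness of the expansion the conditions of all charts bear on one family [F], and the
    charts U_0, ..., U_n meet all the rays 0, ..., n + 1. *)
Lemma charts_spanP n m w : (forall i, (i <= n)%N -> chart_form i m w) <->
  graded_span m (regular m (all_rays n)) w.
Proof.
split=> [H|[F E RF] i ni]; last first.
  apply: chart_form_span; exists F => // chi; apply: sub_regular (RF chi) => r.
  by rewrite /all_rays => /orP[]/eqP->; lia.
have [F E RF] := graded_span_chart_form (H 0%N isT).
exists F => // chi; split=> [|i]; first by case: (RF chi).
have sF chi' : (size (F chi') <= m.+1)%N by case: (RF chi').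
case: i => [_|i ni]; first by apply: (RF chi).2.
have [G EG RG] := graded_span_chart_form (H i ni).
rewrite (expands_inj E EG) => // [|chi']; last by case: (RG chi').
by apply: (RG chi).2; rewrite eqxx orbT.
Qed.

(** A function of order 0 along D_r can be divided out without changing any order along D_r. *)
Lemma chart_loc_span i m chi0 (r : nat) w : (r == i) || (r == i.+1) ->
    ray_ord r chi0 = 0 -> chart_loc i m chi0 w ->
  graded_span m (regular m (pred1 r)) w.
Proof.
move=> ri r0 [N /graded_span_chart_form[F E RF]].
have := expands_shift (chi0 *- N) E.
rewrite -monX mulrA -const2_monD addNr mon0 rmorph1 mul1r => Ew.
exists (fun chi => F (chi - chi0 *- N)) => // chi.
have [sF vF] := RF (chi - chi0 *- N); split=> // r' /eqP->.
have oE : ray_ord r (chi - chi0 *- N) = ray_ord r chi.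
  by rewrite [chi - _]/(chi - - (chi0 *+ N)) opprK ray_ordD ray_ordMn r0 mul0rn addr0.
by have := vF r ri; rewrite /vanish /defect oE.
Qed.

(** Along a divisor on which chi0 has positive order, a high power of it raises all orders of the
    finite support to at least m, and the condition disappears. Along the others nothing changes. *)
Lemma graded_span_chart_loc i m chi0 w (F : int * int -> {poly C}) : expands m w F ->
    (forall chi, size (F chi) <= m.+1)%N ->
    (forall r chi, (r == i) || (r == i.+1) ->
       0 < ray_ord r chi0 \/ ray_ord r chi0 = 0 /\ vanish m r chi (F chi)) ->
  chart_loc i m chi0 w.
Proof.
move=> E sF vF; case: (E) => s Fs _.
pose ab r (chi : int * int) := `|ray_ord r chi|%N.
(* Each factor raises a positive-order divisor by at least 1, so m plus a bound for the orders on
   the support suffices. *)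
pose N := (m + \max_(chi <- s) (ab i chi + ab i.+1 chi))%N.
exists N; apply: chart_form_span; rewrite -monX.
exists (fun chi => F (chi - chi0 *+ N)); first exact: expands_shift.
move=> chi; split=> [//|r ri].
have [cs|/Fs ->] := boolP (chi - chi0 *+ N \in s); last by rewrite /vanish dvdp0.
have Nb : (m + (ab i (chi - chi0 *+ N)%R + ab i.+1 (chi - chi0 *+ N)%R) <= N)%N.
  rewrite leq_add2l.
  by rewrite (leq_bigmax_seq (F := fun chi => (ab i chi + ab i.+1 chi)%N)).
have oE : ray_ord r chi = ray_ord r (chi - chi0 *+ N) + ray_ord r chi0 * N%:Z.
  by rewrite -mulrzz -pmulrn -ray_ordMn -ray_ordD subrK.
have [r_pos|[r0]] := vF r (chi - chi0 *+ N) ri; last first.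
  by rewrite /vanish /defect oE r0 mul0r addr0.
rewrite /vanish (_ : defect m r chi = 0%N) ?expr0 ?dvd1p // /defect oE.
have {Nb} : (m + ab r (chi - chi0 *+ N)%R <= N)%N.
  apply: leq_trans Nb; rewrite leq_add2l.
  by case/orP: ri => /eqP->; rewrite ?leq_addl ?leq_addr.
rewrite /ab; clear -r_pos; move: (ray_ord r (chi - chi0 *+ N)) r_pos.
move: (ray_ord r chi0) (N) => B M A; nia.
Qed.

(** Along D_i the functions x, y, z have orders i, 1, n + 1 - i. Thus x in U_0 detects the condition
    along D_0, z in U_n the one along D_(n+1), and every other order is positive. *)
Lemma loc_spanP n m w : (0 < n)%N ->
  (forall i, (i <= n)%N -> [/\ chart_loc i m (1, 0) w, chart_loc i m (0, 1) w &
     chart_loc i m (-1, n.+1%:Z) w]) <->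
  graded_span m (regular m (end_rays n)) w.
Proof.
move=> n0; split=> [H|[F E RF] i ni].
  have [/(chart_loc_span (r := 0%N)) W0 _ _] := H 0%N isT.
  have [_ _ /(chart_loc_span (r := n.+1)) Wn] := H n (leqnn n).
  have [//||F E RF] := W0; first by rewrite /ray_ord /=; lia.
  have [||G EG RG] := Wn; [by rewrite eqxx orbT|by rewrite /ray_ord /=; lia|].
  exists F => // chi; split=> [|r]; first by case: (RF chi).
  case/orP => /eqP->; first by apply: (RF chi).2; rewrite /= eqxx.
  rewrite (expands_inj E EG); first by apply: (RG chi).2; rewrite /= eqxx.
    by move=> chi'; case: (RF chi').
  by move=> chi'; case: (RG chi').
have sF chi : (size (F chi) <= m.+1)%N by case: (RF chi).
have V0 chi : vanish m 0 chi (F chi) by apply: (RF chi).2.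
have Vn chi : vanish m n.+1 chi (F chi) by apply: (RF chi).2; rewrite /end_rays eqxx orbT.
split; apply: graded_span_chart_loc E sF _ => r chi ri; rewrite /ray_ord /=.
- have [->|] := posnP r; [by right; split => //; lia | by left; lia].
- by left; lia.
- have [->|rn] := eqVneq r n.+1; [by right; split => //; lia | left].
  by case/orP: ri rn => /eqP->; lia.
Qed.

(* Makes the linear forms [lform i] pairwise coprime. *)
Hypothesis natC_inj : injective (fun i : nat => i%:R : C).

(** * A basis of the quotient, character by character *)

Definition lin_prod (e : nat -> nat) (r : seq nat) : {poly C} :=
  \prod_(i <- r) ('X - i%:R%:P) ^+ e i.

Lemma lin_prod_monic e r : lin_prod e r \is monic.
Proof. by apply: monic_prod => i _; rewrite monic_exp ?monicXsubC. Qed.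

Lemma size_lin_prod e r : size (lin_prod e r) = (\sum_(i <- r) e i).+1.
Proof.
rewrite /lin_prod; elim: r => [|i r IH]; first by rewrite !big_nil size_poly1.
rewrite !big_cons size_monicM ?monic_exp ?monicXsubC //; last first.
  by rewrite -size_poly_eq0 IH.
by rewrite IH size_exp_XsubC addnS.
Qed.

Lemma dvdp_lin_prod e r (f : {poly C}) : uniq r ->
  (lin_prod e r %| f) = all (fun i => ('X - i%:R%:P) ^+ e i %| f) r.
Proof.
rewrite /lin_prod; elim: r => [|i r IH] /=; first by rewrite big_nil dvd1p.
move=> /andP[ir ur]; rewrite big_cons Gauss_dvdp ?IH //.
rewrite big_seq; elim/big_ind: _ => [|p q cp cq|j jr].
- exact: coprimep1.
- by rewrite coprimepMr cp cq.
rewrite coprimep_expl // coprimep_expr // coprimep_XsubC2 // subr_eq0.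
by apply: contraNneq ir => /natC_inj <-.
Qed.

Definition end_factor m n chi : {poly C} := lin_prod (defect m ^~ chi) [:: 0%N; n.+1].
Definition mid_factor m n chi : {poly C} := lin_prod (defect m ^~ chi) (index_iota 1 n.+1).

Lemma regular_endP m n chi f : regular m (end_rays n) chi f <->
  (size f <= m.+1)%N /\ end_factor m n chi %| f.
Proof.
rewrite /end_factor dvdp_lin_prod //= andbT; split=> -[sf vf]; split=> //.
  by rewrite [_ %| f]vf // [_ %| f]vf // /end_rays eqxx orbT.
by move=> i /orP[]/eqP->; case/andP: vf.
Qed.

Lemma regular_allP m n chi f : regular m (all_rays n) chi f <->
  (size f <= m.+1)%N /\ end_factor m n chi * mid_factor m n chi %| f.
Proof.
rewrite /end_factor /mid_factor /lin_prod -big_cat -/(lin_prod _ _).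
rewrite dvdp_lin_prod; last first.
  by rewrite /= iota_uniq !inE !mem_index_iota /= ltnn.
split=> -[sf vf]; split=> //.
  apply/allP => i; rewrite mem_cat !inE mem_index_iota => ir; apply: vf.
  by rewrite /all_rays; lia.
move=> i ni; move/allP: vf; apply; rewrite mem_cat !inE mem_index_iota.
by rewrite /all_rays in ni; lia.
Qed.

(** For f divisible by [end_factor], the remainder of the cofactor modulo [mid_factor] represents
    the class of f modulo forms regular along every D_i. *)
Definition residue m n chi (f : {poly C}) : {poly C} :=
  (f %/ end_factor m n chi) %% mid_factor m n chi.

Lemma end_factor_neq0 m n chi : end_factor m n chi != 0.
Proof. exact/monic_neq0/lin_prod_monic. Qed.

Lemma mid_factor_neq0 m n chi : mid_factor m n chi != 0.
Proof. exact/monic_neq0/lin_prod_monic. Qed.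

(** The two terms of the minimum: a remainder is smaller than [mid_factor], and it is no larger than
    the cofactor itself, whose degree is limited by m. *)
Lemma size_residue m n chi f : regular m (end_rays n) chi f ->
  (size (residue m n chi f) <= jump m n chi)%N.
Proof.
move=> /regular_endP[sf _]; rewrite leq_min; apply/andP; split.
  by rewrite -ltnS -size_lin_prod ltn_modp mid_factor_neq0.
rewrite (leq_trans (leq_modp _ _)) // size_divp ?end_factor_neq0 //.
by rewrite size_lin_prod !big_cons big_nil addn0 leq_sub2r.
Qed.

Lemma regular_end_mul m n chi (r : {poly C}) : (size r <= jump m n chi)%N ->
  regular m (end_rays n) chi (end_factor m n chi * r).
Proof.
move=> sr; apply/regular_endP; split; last exact: dvdp_mulIl.
have [->|r0] := eqVneq r 0; first by rewrite mulr0 size_poly0.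
rewrite size_mul ?end_factor_neq0 // size_lin_prod !big_cons big_nil addn0.
move: sr r0; rewrite leq_min -size_poly_gt0 => /andP[_]; move: (size r) (_ + _)%N => a b; lia.
Qed.

Lemma regular_residue m n chi f : regular m (end_rays n) chi f ->
  regular m (all_rays n) chi (f - end_factor m n chi * residue m n chi f).
Proof.
move=> Rf; apply/regular_allP; split.
  have [s1 _] := Rf; have [s2 _] := regular_end_mul (size_residue Rf).
  by rewrite (leq_trans (size_polyD _ _)) // geq_max s1 size_polyN.
have /regular_endP[_ /divpK fE] := Rf.
rewrite -{1}fE [_ %/ _ * _]mulrC -mulrBr dvdp_mul2l ?end_factor_neq0 //.
by rewrite /residue {1}[f %/ _](divp_eq _ (mid_factor m n chi)) addrK dvdp_mull.
Qed.

Lemma regular_all_mul_eq0 m n chi (r : {poly C}) : (size r <= jump m n chi)%N ->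
  regular m (all_rays n) chi (end_factor m n chi * r) -> r = 0.
Proof.
rewrite leq_min => /andP[sr _] /regular_allP[_].
rewrite dvdp_mul2l ?end_factor_neq0 // => /dvdp_leq h.
apply/eqP; apply: contraTT sr => /h; rewrite size_lin_prod.
by rewrite -ltnNge.
Qed.

Definition jump_seq m n (s : seq (int * int)) : seq ((int * int) * nat) :=
  [seq (chi, k) | chi <- s, k <- iota 0 (jump m n chi)].

Lemma size_jump_seq m n s : size (jump_seq m n s) = (\sum_(chi <- s) jump m n chi)%N.
Proof.
rewrite size_allpairs_dep sumnE big_map.
by apply: eq_bigr => chi _; rewrite size_iota.
Qed.

Lemma mem_jump_seq m n s chi k :
  ((chi, k) \in jump_seq m n s) = (chi \in s) && (k < jump m n chi)%N.
Proof.
apply/allpairsPdep/andP => [[chi' [k' [cs]]]|[cs kj]].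
  by rewrite mem_iota => kj [-> ->].
by exists chi, k; rewrite mem_iota.
Qed.

Lemma jump_seq_uniq m n s : uniq s -> uniq (jump_seq m n s).
Proof.
move=> us; apply: allpairs_uniq_dep => //; first by move=> chi _; apply: iota_uniq.
by move=> [a k] [b l] _ _ /= [-> ->].
Qed.

Definition jump_form m n (p : (int * int) * nat) : S :=
  const2 (mon p.1) * theta m (end_factor m n p.1 * 'X^(p.2)).

Lemma expands_jump_sum m n s (cc : (int * int) * nat -> C) : uniq s ->
    (forall chi, chi \notin s -> jump m n chi = 0%N) ->
  expands m (\sum_(p <- jump_seq m n s) const2 (cst (cc p)) * jump_form m n p)
    (fun chi => end_factor m n chi * \poly_(k < jump m n chi) cc (chi, k)).
Proof.
move=> us js; exists s => [chi /js ->|].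
  by rewrite poly_def big_ord0 mulr0.
rewrite big_allpairs_dep undup_id //; apply: eq_bigr => chi _.
rewrite -[X in iota 0 X]subn0 -/(index_iota 0 _) big_mkord poly_def [end_factor _ _ _ * _]mulr_sumr theta_sum mulr_sumr.
apply: eq_bigr => k _; rewrite -scalerAr thetaZ /jump_form /=; ring.
Qed.

(** The basis consists of the chi times [end_factor] 'X^k with k below the jump. Coordinates are the
    coefficients of the residues; they are unique because a multiple of [mid_factor] of size at most
    the jump is zero. *)
Lemma quotient_basis m n s : uniq s ->
    (forall chi, chi \notin s -> jump m n chi = 0%N) ->
  exists b : 'I_(\sum_(chi <- s) jump m n chi) -> S,
    (forall j, graded_span m (regular m (end_rays n)) (b j)) /\
    forall w, graded_span m (regular m (end_rays n)) w ->
      exists! c : 'rV[C]_(\sum_(chi <- s) jump m n chi),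
        graded_span m (regular m (all_rays n)) (w - \sum_j const2 (cst (c 0 j)) * b j).
Proof.
move=> us js; rewrite -size_jump_seq; set L := jump_seq m n s.
have uL : uniq L by apply: jump_seq_uniq.
pose p0 : (int * int) * nat := (0, 0%N).
have sumL (cc : (int * int) * nat -> C) :
    \sum_(j < size L) const2 (cst (cc (nth p0 L j))) * jump_form m n (nth p0 L j) =
    \sum_(p <- L) const2 (cst (cc p)) * jump_form m n p.
  by rewrite [RHS](big_nth p0) big_mkord.
exists (fun j => jump_form m n (nth p0 L j)); split=> [j|w [F E RF]].
  apply: graded_span_mon; first exact: regular_subspaces.
  apply: regular_end_mul; rewrite size_polyXn.
  have : nth p0 L j \in L by apply: mem_nth.
  by case: (nth _ _ _) => chi k; rewrite mem_jump_seq => /andP[].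
pose cc p := (residue m n p.1 (F p.1))`_p.2.
pose c0 : 'rV[C]_(size L) := \row_j cc (nth p0 L j).
have H0 : graded_span m (regular m (all_rays n))
    (w - \sum_j const2 (cst (c0 0 j)) * jump_form m n (nth p0 L j)).
  under eq_bigr do rewrite mxE.
  rewrite (sumL cc); have := expands_linear (-1) E (expands_jump_sum cc us js).
  rewrite !rmorphN1 mulN1r => Ed; eexists; first exact: Ed.
  move=> chi /=; rewrite scaleN1r.
  rewrite (_ : \poly_(k < _) _ = residue m n chi (F chi)).
    exact: regular_residue.
  apply/polyP => k; rewrite coef_poly /cc /=; case: ltnP => // jk.
  by rewrite nth_default // (leq_trans (size_residue (RF chi))).
exists c0; split=> // c H1; clearbody c0.
(* The difference of two coordinate vectors represents 0 in the quotient. *)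
suff e0 : forall e : 'rV[C]_(size L), graded_span m (regular m (all_rays n))
    (\sum_j const2 (cst (e 0 j)) * jump_form m n (nth p0 L j)) -> e = 0.
  apply/eqP; rewrite -subr_eq0; apply/eqP/e0.
  have := graded_span_linear (-1) (@regular_subspaces m (all_rays n)) H1 H0.
  rewrite !rmorphN1 mulN1r opprB addrC addrA subrK -sumrB; congr graded_span.
  by apply: eq_bigr => j _; rewrite -mulrBl -!rmorphB !mxE.
(* [ee] views the row e as a function of the pairs (chi, k), with value 0 off the list. *)
move=> e; pose ee p := if insub (index p L) is Some j then e 0 j else 0.
have eeE (j : 'I_(size L)) : ee (nth p0 L j) = e 0 j.
  by rewrite /ee index_uniq //= valK.
under eq_bigr do rewrite -eeE.
rewrite sumL => -[G EG RG]; have Ej := expands_jump_sum ee us js.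
have sj chi : (size (\poly_(k < jump m n chi) ee (chi, k)) <= jump m n chi)%N.
  exact: size_poly.
have GE := expands_inj EG Ej _ _.
apply/rowP => j; rewrite mxE -eeE.
have : nth p0 L j \in L by apply: mem_nth.
case: (nth _ _ _) => chi k; rewrite mem_jump_seq => /andP[_ kj].
have /regular_all_mul_eq0 : regular m (all_rays n) chi
  (end_factor m n chi * \poly_(k < jump m n chi) ee (chi, k)).
  rewrite -GE // => chi'; first by case: (RG chi').
  by case: (regular_end_mul (sj chi')).
move=> /(_ (sj chi)) /(congr1 (fun q : {poly C} => q`_k)).
by rewrite coef_poly kj coef0.
Qed.

End LaurentForms.

(** * The resolution in toric coordinates *)

Definition is_derivation (A : nzRingType) (D : A -> A) : Prop :=
  forall p q, D (p * q) = D p * q + p * D q.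

Lemma map_deriv_derivation (C : comNzRingType) :
  is_derivation (map_poly (@deriv C)).
Proof.
move=> p q; apply/polyP => i; rewrite coefD coef_map /= !coefM raddf_sum /=.
by rewrite -big_split; apply: eq_bigr => j _; rewrite /= derivM !coef_map.
Qed.

Lemma frac_repr (A : idomainType) (f : {fraction A}) :
  f = tofrac (fraction.frac (repr f)).1 / tofrac (fraction.frac (repr f)).2.
Proof.
case E : (repr f) => [[p q] /= q0].
rewrite -[LHS]reprK E; apply: (canRL (mulfK _)); first by rewrite tofrac_eq0.
unlock FracField.tofrac; rewrite -[LHS]FracField.pi_mul.
apply/eqmodP; rewrite /= FracField.equivfE /FracField.mulf /=.
by rewrite !numden_Ratio ?mulr1 ?oner_neq0 //= mulrC.
Qed.

(** [frac_deriv] uses a chosen representative p / q; applying D to p b = a q shows that a / b gives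
    the same value. *)
Lemma frac_derivE (A : idomainType) (D : A -> A) (a b : A) :
  is_derivation D -> b != 0 ->
  frac_deriv D (tofrac a / tofrac b) =
  tofrac (D a * b - a * D b) / tofrac b ^+ 2.
Proof.
move=> DM b0; have := frac_repr (tofrac a / tofrac b); rewrite /frac_deriv.
case: (repr _) => [[p q] /= q0] E.
have pq : p * b = a * q.
  apply/eqP; rewrite -tofrac_eq !tofracM.
  have: tofrac a / tofrac b * tofrac b * tofrac q = tofrac p / tofrac q * tofrac b * tofrac q by rewrite E.
  rewrite divfK ?tofrac_eq0 // => ->; rewrite mulrAC divfK ?tofrac_eq0 //.
have Dpq : D p * b + p * D b = D a * q + a * D q by rewrite -!DM pq.
apply/eqP; rewrite eqr_div ?expf_neq0 ?tofrac_eq0 // -!tofracXn -!tofracM tofrac_eq.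
apply/eqP; transitivity (q * (b * (D p * b + p * D b)) - q * (p * b) * D b - b * (p * b) * D q).
  ring.
rewrite Dpq pq; ring.
Qed.

(** The matrices expressing each family through the other satisfy B A = 1 by uniqueness of
    coordinates, which forces d1 <= d2. *)
Lemma basis_mod_leq (C : fieldType) (S : comNzRingType) (j : {rmorphism C -> S})
    (W V : S -> Prop) (d1 d2 : nat) (b1 : 'I_d1 -> S) (b2 : 'I_d2 -> S) :
    V 0 -> (forall c w1 w2, V w1 -> V w2 -> V (w1 + j c * w2)) ->
    (forall k, W (b1 k)) -> (forall k, W (b2 k)) ->
    (forall w, W w -> exists! c : 'rV_d1, V (w - \sum_k j (c 0 k) * b1 k)) ->
    (forall w, W w -> exists! c : 'rV_d2, V (w - \sum_k j (c 0 k) * b2 k)) ->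
  (d1 <= d2)%N.
Proof.
move=> V0 VD W1 W2 B1 B2.
have [f fP] := choice (fun l => B1 _ (W2 l)).
have [g gP] := choice (fun k => B2 _ (W1 k)).
pose A := \matrix_(l < d2) f l; pose B := \matrix_(k < d1) g k.
suff BA : B *m A = 1%:M by apply: mulmx1_min BA.
apply/row_matrixP => k; have [c [_ cU]] := B1 _ (W1 k).
(* Row k of B A and row k of the identity are both coordinates of [b1 k] in the family [b1]. *)
transitivity c; [apply: esym|]; apply: cU.
  have VS (F : 'I_d2 -> S) (e : 'I_d2 -> C) : (forall l, V (F l)) ->
      V (\sum_l j (e l) * F l).
    move=> VF; elim/big_ind: _ => [|w1 w2 V1 V2|l _] //.
      by rewrite -[w2]mul1r -(rmorph1 j); exact: VD.
    by rewrite -[X in V X]add0r; apply: VD.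
  have := VD 1 _ _ (gP k).1 (VS _ (g k 0) (fun l => (fP l).1)).
  congr V; rewrite rmorph1 mul1r.
  under [X in _ + X]eq_bigr do rewrite mulrBr.
  rewrite sumrB addrA subrK; congr (_ - _).
  under eq_bigr do rewrite mulr_sumr.
  rewrite exchange_big; apply: eq_bigr => i _ /=.
  rewrite mxE mxE rmorph_sum mulr_suml; apply: eq_bigr => l _ /=.
  by rewrite !mxE rmorphM mulrA.
rewrite (bigD1 k) //= big1 => [|i ik]; last first.
  by rewrite !mxE eq_sym (negPf ik) rmorph0 mul0r.
by rewrite !mxE eqxx rmorph1 mul1r addr0 subrr.
Qed.

Section Differentials.
Variables (K : fieldType) (x y : K).
Hypotheses (x0 : x != 0) (y0 : y != 0).

Lemma quotient_rule_v i :
  - (x * (i%:R * y ^+ i / y)) / (y ^+ i) ^+ 2 = - (i%:R * x / y ^+ i / y).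
Proof.
have : y ^+ i != 0 by rewrite expf_neq0.
by move: (y ^+ i) => z z0; field; rewrite y0 z0.
Qed.

Lemma dlog_u i :
  (- (y ^+ i.+1 / x ^+ 2))%:P%:P * 'X + (i.+1%:R * y ^+ i.+1 / y / x)%:P%:P * 'Y =
  const2 (y ^+ i.+1 / x) * - lform x y i.+1.
Proof.
rewrite mulrN mulrBr opprB addrC /logx /logy -mulrnAl -rmorphMn !mulrA.
rewrite -!(rmorphM (@const2 K)) /const2 /= -mulr_natr; congr (_%:P%:P * _ + _).
  by ring.
by rewrite !polyCN mulNr; congr (- (_%:P%:P * _)); field; rewrite x0.
Qed.

Lemma dlog_v i :
  ((y ^+ i)^-1)%:P%:P * 'X + (- (i%:R * x / y ^+ i / y))%:P%:P * 'Y =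
  const2 (x / y ^+ i) * lform x y i.
Proof.
have : y ^+ i != 0 by rewrite expf_neq0.
rewrite mulrBr /logx /logy -mulrnAl -rmorphMn !mulrA.
rewrite -!(rmorphM (@const2 K)) /const2 /= -mulr_natr; move: (y ^+ i) => z z0.
congr (_%:P%:P * _ + _); first by field; rewrite x0 z0.
by rewrite !polyCN mulNr; congr (- (_%:P%:P * _)); field; rewrite y0 z0.
Qed.

End Differentials.

Section Instance.
Variable R : realType.
Local Notation CC := (complex R).
Local Notation K := {fraction {poly {poly CC}}}.

HB.instance Definition _ := GRing.RMorphism.copy (@cstK R)
  (@FracField.tofrac {poly {poly CC}} \o (@polyC {poly CC} \o @polyC CC)).

Lemma xK_neq0 : xK R != 0.
Proof. by rewrite tofrac_eq0 polyX_eq0. Qed.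

Lemma yK_neq0 : yK R != 0.
Proof. by rewrite tofrac_eq0 polyC_eq0 polyX_eq0. Qed.

Lemma horner_xyK (p : {poly {poly CC}}) :
  (map_poly (map_poly (@cstK R)) p).[xK R, yK R] = tofrac p.
Proof.
rewrite horner2E -[p in RHS]coefK poly_def rmorph_sum; apply: eq_bigr => j _.
rewrite -mul_polyC /= tofracM tofracXn -mulr_suml; congr (_ * _).
rewrite -[p`_j in RHS]coefK poly_def !rmorph_sum; apply: eq_bigr => l _ /=.
by rewrite -mul_polyC polyCM rmorphXn /= tofracM tofracXn.
Qed.

Lemma xyK_free (p : {poly {poly CC}}) :
  (map_poly (map_poly (@cstK R)) p).[xK R, yK R] = 0 -> p = 0.
Proof. by rewrite horner_xyK => /eqP; rewrite tofrac_eq0 => /eqP. Qed.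

Local Notation mon := (mon (xK R) (yK R)).
Local Notation logx := (logx (xK R)).
Local Notation logy := (logy (yK R)).
Local Notation lform := (lform (xK R) (yK R)).

Lemma chartuE i : chartu R i = mon (lcoordu i).
Proof. by rewrite monu. Qed.

Lemma chartvE i : chartv R i = mon (lcoordv i).
Proof. by rewrite monv. Qed.

Lemma map_deriv_X : map_poly (@deriv CC) 'X = 0.
Proof.
apply/polyP => i; rewrite coef_map /= coefX coef0.
by case: eqP => _; rewrite ?derivC // -[1]/(1%:P) derivC.
Qed.

Lemma map_deriv_Yexp k :
  map_poly (@deriv CC) ('Y ^+ k) = ('X^(k.-1) *+ k)%:P.
Proof. by rewrite -rmorphXn /= map_polyC /= derivXn. Qed.

Lemma deriv_Yexp k : ('Y ^+ k : {poly {poly CC}})^`() = 0.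
Proof. by rewrite -rmorphXn /= derivC. Qed.

Lemma tofrac_Yexp k : tofrac ('Y ^+ k : {poly {poly CC}}) = yK R ^+ k.
Proof. exact: tofracXn. Qed.

Lemma chartu_frac i :
  chartu R i = tofrac ('Y ^+ i.+1) / tofrac ('X : {poly {poly CC}}).
Proof. by rewrite tofrac_Yexp. Qed.

Lemma chartv_frac i :
  chartv R i = tofrac ('X : {poly {poly CC}}) / tofrac ('Y ^+ i).
Proof. by rewrite tofrac_Yexp. Qed.

Lemma tofrac_map_deriv_Y k :
  tofrac ('X^(k.-1) *+ k : {poly CC})%:P = k%:R * yK R ^+ k / yK R.
Proof.
rewrite polyCMn tofracMn rmorphXn /= tofracXn -/(yK R).
case: k => [|k]; first by rewrite mulr0n !mul0r.
by rewrite exprSr mulrA mulfK ?yK_neq0 // mulr_natl.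
Qed.

Lemma frac_deriv_chartu_x i :
  frac_deriv (@deriv {poly CC}) (chartu R i) = - (yK R ^+ i.+1 / xK R ^+ 2).
Proof.
rewrite chartu_frac frac_derivE ?polyX_eq0 //; last first.
  exact: derivM.
by rewrite deriv_Yexp derivX mul0r mulr1 sub0r tofracN tofrac_Yexp mulNr.
Qed.

Lemma frac_deriv_chartu_y i :
  frac_deriv (map_poly (@deriv CC)) (chartu R i) =
  i.+1%:R * yK R ^+ i.+1 / yK R / xK R.
Proof.
rewrite chartu_frac frac_derivE ?polyX_eq0 //; last first.
  exact: map_deriv_derivation.
rewrite map_deriv_Yexp map_deriv_X mulr0 subr0 tofracM tofrac_map_deriv_Y -/(xK R).
by rewrite [xK R ^+ 2]expr2 invfM mulrA mulfK ?xK_neq0.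
Qed.

Lemma frac_deriv_chartv_x i :
  frac_deriv (@deriv {poly CC}) (chartv R i) = (yK R ^+ i)^-1.
Proof.
rewrite chartv_frac frac_derivE; last 2 first.
- exact: derivM.
- by rewrite expf_neq0 // polyC_eq0 polyX_eq0.
rewrite deriv_Yexp derivX mul1r mulr0 subr0 tofrac_Yexp.
by rewrite expr2 invfM mulrA mulfV ?mul1r // expf_neq0 // yK_neq0.
Qed.

Lemma frac_deriv_chartv_y i :
  frac_deriv (map_poly (@deriv CC)) (chartv R i) =
  - (i%:R * xK R / yK R ^+ i / yK R).
Proof.
rewrite chartv_frac frac_derivE; last 2 first.
- exact: map_deriv_derivation.
- by rewrite expf_neq0 // polyC_eq0 polyX_eq0.
rewrite map_deriv_X mul0r sub0r map_deriv_Yexp tofracN tofracM.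
rewrite tofrac_map_deriv_Y tofrac_Yexp -/(xK R).
by rewrite quotient_rule_v ?yK_neq0.
Qed.

Lemma dK_chartu i : dK (chartu R i) = const2 (mon (lcoordu i)) * - lform i.+1.
Proof.
rewrite /dK frac_deriv_chartu_x frac_deriv_chartu_y monu.
apply: dlog_u; exact: xK_neq0.
Qed.

Lemma dK_chartv i : dK (chartv R i) = const2 (mon (lcoordv i)) * lform i.
Proof.
rewrite /dK frac_deriv_chartv_x frac_deriv_chartv_y monv.
apply: dlog_v; [exact: xK_neq0 | exact: yK_neq0].
Qed.

Local Notation cst := (@cstK R).
Local Notation chart_form := (chart_form cst (xK R) (yK R)).

Lemma sym_chartP i m w : sym_chart i m w <-> chart_form i m w.
Proof.
split=> -[a ->]; exists a; apply: eq_bigr => k _.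
  by rewrite dK_chartu dK_chartv /chart_fun chartuE chartvE.
by rewrite dK_chartu dK_chartv /chart_fun chartuE chartvE.
Qed.

Lemma H0_resP n m w : H0_res n m w <->
  graded_span cst (xK R) (yK R) m (regular m (all_rays n)) w.
Proof.
rewrite -(charts_spanP xK_neq0 yK_neq0 xyK_free); split.
  move=> H i ni.
  exact: (proj1 (sym_chartP i m w) (H (Ordinal (ni : (i < n.+1)%N)))).
by move=> H i; exact: (proj2 (sym_chartP i m w) (H i (leq_ord i))).
Qed.

Lemma H0_res_minusEP n m w : (0 < n)%N -> H0_res_minusE n m w <->
  graded_span cst (xK R) (yK R) m (regular m (end_rays n)) w.
Proof.
move=> n0; rewrite -(loc_spanP xK_neq0 yK_neq0 xyK_free) //.
have xE : mon (1, 0) = xK R by rewrite /mon /= expr1z expr0z mulr1.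
have yE : mon (0, 1) = yK R by rewrite /mon /= expr1z expr0z mul1r.
have zE : mon (-1, n.+1%:Z) = zK R n by rewrite /mon /= exprN1 mulrC.
have locP f chi i : mon chi = f -> sym_chart_loc i m f w <->
    chart_loc cst (xK R) (yK R) i m chi w.
  move=> <-; split=> -[N c]; exists N.
    exact: (proj1 (sym_chartP i m _) c).
  exact: (proj2 (sym_chartP i m _) c).
split=> H i.
  move=> ni; have [hx hy hz] := H (Ordinal (ni : (i < n.+1)%N)).
  split; [exact: (proj1 (locP _ _ _ xE) hx) | exact: (proj1 (locP _ _ _ yE) hy) |
    exact: (proj1 (locP _ _ _ zE) hz)].
have [hx hy hz] := H i (leq_ord i).
split; [exact: (proj2 (locP _ _ _ xE) hx) | exact: (proj2 (locP _ _ _ yE) hy) |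
  exact: (proj2 (locP _ _ _ zE) hz)].
Qed.

Lemma nat_complex_inj : injective (fun i : nat => i%:R : CC).
Proof. by move=> i j /eqP; rewrite eqr_nat => /eqP. Qed.

Lemma is_hbar0_jump n m (s : seq (int * int)) : (0 < n)%N -> uniq s ->
    (forall chi, chi \notin s -> jump m n chi = 0%N) ->
  is_hbar0 R n m (\sum_(chi <- s) jump m n chi).
Proof.
move=> n0 us js.
have [b [Wb bP]] := quotient_basis xK_neq0 yK_neq0 xyK_free nat_complex_inj us js.
exists b; split=> [j|w Ww].
  exact: (proj2 (H0_res_minusEP _ _ n0) (Wb j)).
have [c [Hc cU]] := bP w (proj1 (H0_res_minusEP _ _ n0) Ww).
exists c; split=> [|c' Hc']; first exact: (proj2 (H0_resP _ _ _) Hc).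
exact: cU (proj1 (H0_resP _ _ _) Hc').
Qed.

Lemma is_hbar0_inj n m d1 d2 :
  is_hbar0 R n m d1 -> is_hbar0 R n m d2 -> d1 = d2.
Proof.
have V0 : @H0_res R n m 0.
  apply: (proj2 (H0_resP n m 0)).
  apply: graded_span0; exact: regular_subspaces.
have VD c w1 w2 : @H0_res R n m w1 -> @H0_res R n m w2 ->
    @H0_res R n m (w1 + inSym (cst c) * w2).
  move=> s1 s2; refine (proj2 (H0_resP n m _) _).
  apply: graded_span_linear (proj1 (H0_resP n m _) s1) (proj1 (H0_resP n m _) s2).
  exact: regular_subspaces.
pose j : {rmorphism CC -> symK R} := @const2 K \o cst.
move=> [b1 [W1 B1]] [b2 [W2 B2]]; apply/eqP; rewrite eqn_leq.
by rewrite (basis_mod_leq (j := j) V0 VD W1 W2 B1 B2)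
  (basis_mod_leq (j := j) V0 VD W2 W1 B2 B1).
Qed.

Lemma hbar0E n m d : is_hbar0 R n m d -> hbar0 R n m = d.
Proof.
move=> H; have Hx : is_hbar0 R n m (hbar0 R n m).
  by have := @xgetPex nat 0%N [set d | is_hbar0 R n m d]; apply; exists d.
exact: is_hbar0_inj Hx H.
Qed.

End Instance.

(** * The weighted lattice sum *)

Definition polygon_point (n m : nat) (chi : int * int) : int * int :=
  (2 * chi.2 - m%:Z + n.+1%:Z * chi.1, - chi.1).

Lemma polygon_point_inj n m : injective (polygon_point n m).
Proof. by move=> [a b] [a' b'] [] /= h1 h2; congr pair; lia. Qed.

Lemma jump_bounds m n chi : jump m n chi != 0%N ->
  (exists2 i, (0 < i <= n)%N & ray_ord i chi < m%:Z) /\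
  m%:Z <= ray_ord 0 chi + ray_ord n.+1 chi /\
  0 <= ray_ord 0 chi /\ 0 <= ray_ord n.+1 chi.
Proof.
rewrite /jump -lt0n leq_min => /andP[sum_gt0 end_gt0]; split.
  have [/hasP[j]|/hasPn h] :=
      boolP (has (fun i => 0 < defect m i chi)%N (index_iota 1 n.+1)).
    by rewrite mem_index_iota ltnS => j1n d0; exists j => //; rewrite /defect in d0; lia.
  move: sum_gt0; rewrite big_seq big1 // => i /h.
  by rewrite -eqn0Ngt => /eqP.
by move: end_gt0; rewrite /defect; lia.
Qed.

Lemma jump_polygon (R : realType) m n chi : jump m n chi != 0%N ->
  polygon n m (int_point R (polygon_point n m chi)).
Proof.
move=> /jump_bounds[[i /andP[i0 ni] im] [e [e0 en]]].
have intR (z : int) (p q : R) : z <= 0 -> z%:~R = p - q -> p <= q.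
  by rewrite -(ler_int R) -[p <= q]subr_le0 => z0 <-.
have simp := (rmorphB, rmorphD, rmorphM, rmorphN).
(* As x_2 = - a, the sign of a selects the upper half of the polygon or its reflection. *)
have [a0|a0] := leP chi.1 0; [left | right];
  rewrite /upper_polygon /int_point /polygon_point /=; split.
- apply: (intR (m%:Z - 2 * chi.2 - n.+1%:Z * chi.1)); last by rewrite !simp /= -!pmulrn; ring.
  by move: e; rewrite /ray_ord; lia.
- by apply: (intR chi.1) => //; rewrite !simp /=; ring.
- apply: (intR (2 * (chi.2 + n%:Z * chi.1 - m%:Z))); first by move: im; rewrite /ray_ord; nia.
  by rewrite !simp /= -!pmulrn -natr1; ring.
- apply: (intR (- 2 * (chi.2 + n.+1%:Z * chi.1 + 1))); first by move: en; rewrite /ray_ord; nia.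
  by rewrite !simp /= -!pmulrn -natr1; ring.
- apply: (intR (m%:Z - 2 * chi.2 - n.+1%:Z * chi.1)); last by rewrite !simp /= -!pmulrn; ring.
  by move: e; rewrite /ray_ord; lia.
- by apply: (intR (- chi.1)); [lia | rewrite !simp /=; ring].
- apply: (intR (2 * (chi.2 + chi.1 - m%:Z))); first by move: im; rewrite /ray_ord; nia.
  by rewrite !simp /= -!pmulrn -natr1; ring.
- apply: (intR (- 2 * (chi.2 + 1))); first by move: e0; rewrite /ray_ord; nia.
  by rewrite !simp /= -!pmulrn -natr1; ring.
Qed.

(** The substitution turns the fraction for r into m - k_(r+1), so that r = -1 and r = n stand for
    D_0 and D_(n+1). *)
Lemma alphaE (R : realType) n m i chi :
  alpha n m (i%:Z - 1) (int_point R (polygon_point n m chi)) = (defect m i chi)%:R.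
Proof.
rewrite /alpha /int_point /polygon_point /=.
rewrite (_ : _ / 2 = (m%:Z - ray_ord i chi)%:~R); last first.
  by rewrite /ray_ord !(rmorphB, rmorphD, rmorphM, rmorphN) /= -!pmulrn -natr1; field.
rewrite /defect -[0 : R]/(0%:~R : R) maxEle (ler_int R).
case: leP => h; last by [].
by rewrite -[in LHS](gez0_abs h) -pmulrn.
Qed.

Lemma weightE (R : realType) n m chi :
  weight n m (int_point R (polygon_point n m chi)) = (jump m n chi)%:R.
Proof.
rewrite /weight /beta (_ : -1 = 0%:Z - 1) // alphaE.
rewrite (_ : n%:Z = n.+1%:Z - 1) ?alphaE; last by lia.
rewrite (eq_bigr (fun r : 'I_n => (defect m r.+1 chi)%:R)) => [|r _]; last first.
  by rewrite -(alphaE R n) (_ : r.+1%:Z - 1 = r) //; lia.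
rewrite -natr_sum /jump (_ : Num.max 0 _ =
  (m.+1 - (defect m 0 chi + defect m n.+1 chi))%N%:R); last first.
  case: (leqP (defect m 0 chi + defect m n.+1 chi) m.+1) => h.
    rewrite natrB // natrD -natr1 opprD addrA max_r //.
    by move: h; rewrite -(ler_nat R) natrD -natr1; lra.
  rewrite max_l; first by move/ltnW: h; rewrite -subn_eq0 => /eqP->.
  by move: h; rewrite -(ltr_nat R) natrD -natr1; lra.
have -> : (\sum_(r < n) defect m r.+1 chi = \sum_(1 <= i < n.+1) defect m i chi)%N.
  by rewrite big_add1 big_mkord.
rewrite minEle ler_nat /minn; move: (\sum_(_ <= _ < _) _)%N => A.
by case: ltngtP => // ->.
Qed.

(** Both sums have the same nonzero terms: the parity condition describes the image of
    [polygon_point], and [jump_polygon] places every nonzero jump in the polygon. *)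
Lemma lattice_sum (R : realType) n m (s : seq (int * int)) : uniq s ->
    (forall chi, chi \notin s -> jump m n chi = 0%N) ->
  (\sum_(chi <- s) jump m n chi)%N%:R =
  \sum_(x \in lattice_points R n m) weight n m (int_point R x).
Proof.
move=> us js; rewrite fsbig_supp (@fsbig_fwiden _ _ _ _ (map (polygon_point n m) s)).
- rewrite big_map natr_sum; apply: eq_bigr => chi _; exact/esym/weightE.
- move=> x [[_ par] /= wx].
  (* The preimage under [polygon_point]; parity makes the division by 2 exact. *)
  pose chi : int * int := (- x.2, ((x.1 + m%:Z + n.+1%:Z * x.2) %/ 2)%Z).
  have xE : x = polygon_point n m chi.
    rewrite [LHS]surjective_pairing /polygon_point /=; congr pair; last by lia.
    by move: par; case: x {wx chi} => a b /=; lia.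
  apply/mapP; exists chi => //; apply: contra_notT wx => /js j0.
  by rewrite xE weightE j0.
- by rewrite map_inj_uniq //; exact: polygon_point_inj.
move=> x [/mapP[chi cs ->]] /= nx; apply: contrapT => wx; apply: nx; split=> //.
split; first by apply: jump_polygon; apply: contra_not_neq wx => j0; rewrite weightE j0.
by rewrite /polygon_point /=; lia.
Qed.

(** * Enumeration of the lattice by unimodular cones *)

(* The lattice point with [a = chi.1] and [c = m - chi.2], in which
   [defect m i] becomes the positive part of [c - i a]. *)
Definition shifted (m a c : nat) : int * int := (a%:Z, m%:Z - c%:Z).

Definition mirror (n : nat) (chi : int * int) : int * int :=
  (- chi.1, chi.2 + n.+1%:Z * chi.1).

Lemma mirrorK n : involutive (mirror n).
Proof. by case=> a b; rewrite /mirror /=; congr pair; lia. Qed.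

Lemma defect_shifted m a c i : defect m i (shifted m a c) = (c - i * a)%N.
Proof. by rewrite /defect /ray_ord /=; nia. Qed.

Lemma defect_mirror m n i chi : (i <= n.+1)%N ->
  defect m i (mirror n chi) = defect m (n.+1 - i) chi.
Proof.
move=> ni; congr (`|Num.max _ (_ - _)%R|%N).
by case: chi => a b; rewrite /ray_ord /= -subzn //; lia.
Qed.

Lemma jump_mirror m n chi : jump m n (mirror n chi) = jump m n chi.
Proof.
rewrite /jump !defect_mirror // subn0 subnn addnC; congr minn.
rewrite [RHS]big_nat_rev big_nat [RHS]big_nat /=; apply: eq_bigr => i /andP[_ ni].
by rewrite defect_mirror ?add1n ?subSS // ltnW.
Qed.

Lemma jump_shifted m n a c :
  jump m n (shifted m a c) =
  (m.+1 - (c + (c - n.+1 * a)) - (m.+1 - \sum_(i < n.+2) (c - i * a)))%N.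
Proof.
rewrite /jump !defect_shifted mul0n subn0.
under eq_bigr do rewrite defect_shifted.
rewrite big_ord_recl big_ord_recr /= mul0n subn0 big_add1 big_mkord /bump /=.
under [in RHS]eq_bigr do rewrite add1n.
move: (\sum_(_ < n) _)%N => A; lia.
Qed.

Lemma sum_subn i : (\sum_(j < i.+1) (i - j) = 'C(i.+1, 2))%N.
Proof.
rewrite -bin2_sum big_mkord (reindex_inj rev_ord_inj) /=.
by apply: eq_bigr => j _; rewrite subSS subKn // -ltnS.
Qed.

(** On this cone c - j a = (i - j) p + (i + 1 - j) q, which is nonnegative for j <= i and truncated
    to 0 for j > i. The coefficients of p and q therefore sum to binomials. *)
Lemma jump_cone m n i p q : (i <= n)%N ->
  jump m n (shifted m (p + q) (i * (p + q) + q)) =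
  (m.+1 - (i * p + i.+1 * q) - (m.+1 - ('C(i.+1, 2) * p + 'C(i.+2, 2) * q)))%N.
Proof.
move=> ni; rewrite jump_shifted (_ : (_ - n.+1 * _ = 0)%N); last by nia.
rewrite addn0 (_ : (i * (p + q) + q = i * p + i.+1 * q)%N); last by lia.
congr (_ - (_ - _))%N.
rewrite -(big_mkord xpredT (fun j => (i * p + i.+1 * q - j * (p + q))%N)).
have S2 : (\sum_(i.+1 <= j < n.+2) (i * p + i.+1 * q - j * (p + q)) = 0)%N.
  by rewrite big_nat big1 // => j /andP[ij _]; nia.
rewrite (big_cat_nat (n := i.+1)) ?S2 /=; [|by []|by lia].
have sumS : (\sum_(j < i.+1) (i.+1 - j) = 'C(i.+2, 2))%N.
  by rewrite -sum_subn [RHS]big_ord_recr /= subnn addn0.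
rewrite -sum_subn -sumS !big_distrl big_mkord -big_split addn0 /=.
by apply: eq_bigr => j _ /=; have := ltn_ord j; nia.
Qed.

(** In the last cone c - j a = (n + 1 - j) p + q is never truncated. *)
Lemma jump_last m n p q :
  jump m n (shifted m p (n.+1 * p + q)) =
  (m.+1 - (n.+1 * p + 2 * q) - (m.+1 - ('C(n.+2, 2) * p + n.+2 * q)))%N.
Proof.
rewrite jump_shifted addKn -addnA addnn -mul2n; congr (_ - (_ - _))%N.
have -> : (n.+2 * q = \sum_(j < n.+2) q)%N by rewrite sum_nat_const card_ord.
rewrite -sum_subn big_distrl -big_split.
by apply: eq_bigr => j _ /=; have := ltn_ord j; nia.
Qed.

(* [(i, (p, q))] is the point p (1, i) + q (1, i + 1) in the coordinates (a, c). *)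
Definition cone_index (m n : nat) : seq (nat * (nat * nat)) :=
  [seq (i, pq) | i <- iota 1 n, pq <- [seq (p, q) | p <- iota 1 m, q <- iota 0 m.+1]].

(** With p >= 1 and q >= 0 each cone omits its upper ray, which starts the next one, so the cones
    are disjoint. The final ray a = 0 is added in [all_points]. *)
Definition cone_points (m n : nat) : seq (nat * nat) :=
  [seq (t.2.1 + t.2.2, t.1 * (t.2.1 + t.2.2) + t.2.2)%N | t <- cone_index m n] ++
  [seq (p, n.+1 * p + q)%N | p <- iota 1 m, q <- iota 0 m.+1].

Definition half_points (m n : nat) : seq (int * int) :=
  [seq shifted m t.1 t.2 | t <- cone_points m n].

Definition all_points (m n : nat) : seq (int * int) :=
  half_points m n ++ [seq mirror n chi | chi <- half_points m n] ++
  [seq shifted m 0 q | q <- iota 0 m.+1].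

Lemma mem_cone_index m n i p q :
  ((i, (p, q)) \in cone_index m n) =
  [&& (0 < i <= n)%N, (0 < p <= m)%N & (q <= m)%N].
Proof.
apply/idP/idP => [/allpairsPdep[i' [[p' q'] [i1 pq [-> -> ->]]]]|/and3P[i1 p1 q1]].
  case/allpairsPdep: pq => p1 [q1 []]; rewrite !mem_iota => ? ? [-> ->].
  by move: i1; rewrite mem_iota; lia.
apply: allpairs_f; first by rewrite mem_iota; lia.
by apply: allpairs_f; rewrite mem_iota; lia.
Qed.

Lemma cone_index_uniq m n : uniq (cone_index m n).
Proof.
apply: allpairs_uniq; [exact: iota_uniq| |by move=> [? ?] [? ?] _ _ /= [-> ->]].
by apply: allpairs_uniq; rewrite ?iota_uniq // => -[? ?] [? ?] _ _ /= [-> ->].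
Qed.

Lemma cone_points_uniq m n : uniq (cone_points m n).
Proof.
(* The cone of a point is recovered as the quotient of c by a, because q < p + q. *)
have divE i p q : (0 < p)%N -> ((i * (p + q) + q) %/ (p + q) = i)%N.
  by move=> p0; rewrite divnMDl ?divn_small ?addn0 //; lia.
rewrite cat_uniq; apply/and3P; split.
- rewrite map_inj_in_uniq ?cone_index_uniq //.
  move=> [i [p q]] [i' [p' q']] /=; rewrite !mem_cone_index.
  move=> /and3P[_ /andP[p0 _] _] /and3P[_ /andP[p0' _] _] [e1 e2].
  have ii' : i = i' by rewrite -(divE i p q p0) e2 e1 divE.
  by subst i'; congr (_, (_, _)); nia.
- apply/hasPn => -[a c] /allpairsPdep[p [q [p1 _ [-> ->]]]].
  apply/negP => /mapP[[i [p' q']]]; rewrite mem_cone_index /=.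
  move=> /and3P[/andP[i0 ni] /andP[p0 _] _] [-> e].
  nia.
- by apply: allpairs_uniq; rewrite ?iota_uniq // => -[p q] [p' q'] _ _ /= [-> /addnI ->].
Qed.

Lemma shifted_inj m : injective (fun t : nat * nat => shifted m t.1 t.2).
Proof. by move=> [a c] [a' c'] [] /= h1 h2; congr pair; lia. Qed.

Lemma half_points_gt0 m n chi : chi \in half_points m n -> 0 < chi.1.
Proof.
move=> /mapP[[a c] + ->]; rewrite mem_cat => /orP[/mapP[[i [p q]]]|/allpairsPdep[p [q []]]] /=.
  by rewrite mem_cone_index => /and3P[_ /andP[p0 _] _] [-> _]; lia.
by rewrite mem_iota => p0 _ [-> _]; lia.
Qed.

Lemma all_points_uniq m n : uniq (all_points m n).
Proof.
have hu : uniq (half_points m n).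
  by rewrite map_inj_uniq ?cone_points_uniq //; exact: shifted_inj.
have cross (s : seq (int * int)) : (forall chi, chi \in s -> chi.1 <= 0) ->
    ~~ has (mem (half_points m n)) s.
  move=> s0; apply/hasPn => chi /s0 h; apply/negP => /half_points_gt0; lia.
rewrite !cat_uniq hu; apply/and5P; split => //.
- apply: cross => chi; rewrite mem_cat => /orP[]/mapP[].
    by move=> chi' /half_points_gt0 h ->; rewrite /= lerNl oppr0 ltW.
  by move=> q _ ->.
- by rewrite map_inj_uniq ?hu //; exact/inv_inj/mirrorK.
- apply/hasPn => chi /mapP[q _ ->]; apply/negP => /mapP[chi' /half_points_gt0 h].
  by move=> /(congr1 fst) /= e; move: h; rewrite -oppr_lt0 -e.
- by rewrite map_inj_uniq ?iota_uniq //; move=> q q' []; lia.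
Qed.

Lemma mem_half_points m n (a c : nat) : (0 < a)%N -> (a < c)%N ->
  (a <= m)%N -> (c <= n.+1 * a + m)%N -> shifted m a c \in half_points m n.
Proof.
move=> a0 ac am cm; apply/mapP; exists (a, c) => //; rewrite mem_cat; apply/orP.
have [ca|ca] := leqP (n.+1 * a) c.
  right; apply/allpairsPdep; exists a, (c - n.+1 * a)%N; rewrite !mem_iota.
  by split; [lia | lia | congr pair; lia].
(* Euclidean division of c by a gives i as quotient and q as remainder, and p = a - q. *)
left; have qa : (c %% a < a)%N by rewrite ltn_mod.
have cE := divn_eq c a.
apply/mapP; exists ((c %/ a)%N, ((a - c %% a)%N, (c %% a)%N)).
  rewrite mem_cone_index divn_gt0 // (ltnW ac) /= -ltnS ltn_divLR // ca /=.
  by apply/andP; split; lia.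
by rewrite /= subnK ?(ltnW qa) // -cE.
Qed.

Lemma jump_all_points m n chi : chi \notin all_points m n -> jump m n chi = 0%N.
Proof.
apply: contraNeq => /jump_bounds[[i /andP[i0 ni] im] [e [e0 en]]].
rewrite /all_points !mem_cat; case: chi im e e0 en => a b im e e0 en.
rewrite /ray_ord /= in im e e0 en; have [a0|a0|a0] := ltgtP a 0.
- apply/or3P/Or32; apply/mapP; exists (mirror n (a, b)); last by rewrite mirrorK.
  have -> : mirror n (a, b) = shifted m `|a|%N `|(m%:Z - b - n.+1%:Z * a)%R|%N.
    by rewrite /mirror /shifted /=; congr pair; nia.
  by apply: mem_half_points; nia.
- apply/or3P/Or31.
  have -> : (a, b) = shifted m `|a|%N `|(m%:Z - b)%R|%N.
    by rewrite /shifted /=; congr pair; nia.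
  by apply: mem_half_points; nia.
apply/or3P/Or33/mapP; exists `|(m%:Z - b)%R|%N; first by rewrite mem_iota; lia.
by rewrite /shifted a0; congr pair; lia.
Qed.

(** For positive A and B a term vanishes once p or q exceeds m, so this is the sum of max(0, M - A p
    - B q) over the whole half-open cone, M = m + 1. *)
Definition cone_sum (m A B : nat) : nat :=
  \sum_(1 <= p < m.+1) \sum_(0 <= q < m.+1) (m.+1 - (A * p + B * q)).

Definition axis_sum (m B : nat) : nat := \sum_(0 <= q < m.+1) (m.+1 - B * q).

Lemma leq_bin2 i : (i <= 'C(i.+1, 2))%N.
Proof. by rewrite binS bin1 leq_addl. Qed.

Lemma big_iota (V : nmodType) (i k : nat) (F : nat -> V) :
  \sum_(j <- iota i k) F j = \sum_(i <= j < i + k) F j.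
Proof. by rewrite /index_iota addKn. Qed.

Lemma sum_half_points (R : realDomainType) m n :
  (\sum_(chi <- half_points m n) jump m n chi)%N%:R =
  \sum_(1 <= i < n.+1) ((cone_sum m i i.+1)%:R -
                        (cone_sum m 'C(i.+1, 2) 'C(i.+2, 2))%:R) +
  ((cone_sum m n.+1 2)%:R - (cone_sum m 'C(n.+2, 2) n.+2)%:R) :> R.
Proof.
rewrite natr_sum big_map big_cat big_map /cone_index big_allpairs_dep.
rewrite [X in _ + X = _]big_allpairs_dep (big_iota 1 n) (big_iota 1 m) !add1n; congr (_ + _).
  rewrite big_nat [RHS]big_nat; apply: eq_bigr => i /andP[i0 ni].
  rewrite big_allpairs_dep (big_iota 1 m) add1n /cone_sum !natr_sum -sumrB.
  apply: eq_bigr => p _; rewrite (big_iota 0 m.+1) add0n !natr_sum -sumrB.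
  apply: eq_bigr => q _; rewrite jump_cone // natrB // leq_sub2l //.
  (* i <= 'C(i.+1, 2) yields g_0 <= g, so the subtraction of naturals is exact. *)
  by rewrite leq_add // leq_mul2r leq_bin2 orbT.
rewrite /cone_sum !natr_sum -sumrB; apply: eq_bigr => p _.
rewrite (big_iota 0 m.+1) add0n !natr_sum -sumrB; apply: eq_bigr => q _.
rewrite jump_last natrB // leq_sub2l // leq_add // leq_mul2r ?orbT //.
by rewrite leq_bin2 orbT.
Qed.

Lemma sum_all_points (R : realDomainType) m n :
  (\sum_(chi <- all_points m n) jump m n chi)%N%:R =
  2 * (\sum_(1 <= i < n.+1) ((cone_sum m i i.+1)%:R -
                        (cone_sum m 'C(i.+1, 2) 'C(i.+2, 2))%:R) +
    ((cone_sum m n.+1 2)%:R - (cone_sum m 'C(n.+2, 2) n.+2)%:R)) +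
  ((axis_sum m 2)%:R - (axis_sum m n.+2)%:R) :> R.
Proof.
have axisE : (\sum_(chi <- [seq shifted m 0 q | q <- iota 0 m.+1]) jump m n chi)%N%:R =
    (axis_sum m 2)%:R - (axis_sum m n.+2)%:R :> R.
  rewrite natr_sum (big_map (shifted m 0)) (big_iota 0 m.+1) add0n /axis_sum.
  rewrite !natr_sum -sumrB; apply: eq_bigr => q _.
  rewrite (_ : shifted m 0 q = shifted m 0 (n.+1 * 0 + q)); last by rewrite muln0.
  by rewrite jump_last !muln0 !add0n natrB // leq_sub2l // leq_mul2r orbT.
rewrite -sum_half_points -axisE !natr_sum !big_cat (big_map (mirror n)).
have -> : \sum_(chi <- half_points m n) (jump m n (mirror n chi))%:R =
    \sum_(chi <- half_points m n) (jump m n chi)%:R :> R.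
  by apply: eq_bigr => chi _; rewrite jump_mirror.
by rewrite mulr2n mulrDl mul1r -addrA.
Qed.

(** * Asymptotics of the cone sums *)

Section PowerSums.
Variable R : realFieldType.

Lemma sum_trunc_small (f : nat -> R) B M L : f 0%N = 0 -> (M <= B)%N -> (M <= L)%N ->
  \sum_(0 <= q < L) f (M - B * q)%N = f M.
Proof.
move=> f0 MB; case: L => [|L] ML.
  by rewrite big_nil (_ : M = 0%N) ?f0 //; lia.
rewrite big_nat_recl // muln0 subn0 big1 ?addr0 // => q _.
by rewrite (_ : (M - B * q.+1 = 0)%N) ?f0 //; nia.
Qed.

Lemma sum_trunc_rec (f : nat -> R) B M L :
  \sum_(0 <= q < L.+1) f (M + B - B * q)%N =
  f (M + B)%N + \sum_(0 <= q < L) f (M - B * q)%N.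
Proof.
rewrite big_nat_recl // muln0 subn0; congr (_ + _).
by apply: eq_bigr => q _; congr f; nia.
Qed.

Lemma trunc_ind (P : nat -> nat -> Prop) B : (0 < B)%N ->
  (forall M L, (M <= B)%N -> (M <= L)%N -> P M L) ->
  (forall M L, (M <= L)%N -> P M L -> P (M + B)%N L.+1) ->
  forall M L, (M <= L)%N -> P M L.
Proof.
move=> B0 Psmall Prec M; have [k] := ubnP M; elim: k M => // k IH M Mk L ML.
have [MB|BM] := leqP M B; first exact: Psmall.
case: L ML => [|L] ML; first by lia.
rewrite -(subnK (ltnW BM)); apply: Prec; first by lia.
by apply: IH; lia.
Qed.

(** The error is unchanged when M grows by B, and for M <= B it equals M (B - M) / (2 B). *)
Lemma sum_trunc1 B M L : (0 < B)%N -> (M <= L)%N ->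
  let E : R := \sum_(0 <= q < L) (M - B * q)%:R
           - (M%:R ^+ 2 / (2 * B%:R) + M%:R / 2) in
  0 <= E <= B%:R.
Proof.
move=> B0; move: M L; apply: (trunc_ind B0) => M L.
  move=> MB ML; rewrite (sum_trunc_small (f := fun k => k%:R)) //.
  have Bp : 0 < B%:R :> R by rewrite ltr0n.
  have -> : M%:R - (M%:R ^+ 2 / (2 * B%:R) + M%:R / 2) =
     M%:R * (B%:R - M%:R) / (2 * B%:R) :> R by field; rewrite gt_eqF.
  have Mp : 0 <= M%:R :> R by rewrite ler0n.
  have MBr : M%:R <= B%:R :> R by rewrite ler_nat.
  apply/andP; split; first by rewrite divr_ge0 ?mulr_ge0 ?subr_ge0 ?ler0n.
  by rewrite ler_pdivrMr ?mulr_gt0 //; nra.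
move=> ML /= IH; rewrite (sum_trunc_rec (fun k => k%:R)).
have Bp : B%:R != 0 :> R by rewrite pnatr_eq0 -lt0n.
move: IH; set s := \sum_(_ <= _ < _) _ => IH.
rewrite (_ : _ - _ = s - (M%:R ^+ 2 / (2 * B%:R) + M%:R / 2)) //.
by rewrite natrD; field.
Qed.

(** Here the error grows by B^2 / 6 whenever M grows by B, hence at most linearly in M. *)
Lemma sum_trunc2 B M L : (0 < B)%N -> (M <= L)%N ->
  `| \sum_(0 <= q < L) (M - B * q)%:R ^+ 2
     - (M%:R ^+ 3 / (3 * B%:R) + M%:R ^+ 2 / 2) | <= B%:R * M%:R :> R.
Proof.
move=> B0; have Bp : 0 < B%:R :> R by rewrite ltr0n.
move: M L; apply: (trunc_ind B0) => M L.
  move=> MB ML; rewrite (sum_trunc_small (f := fun k => k%:R ^+ 2)) ?expr0n //.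
  have -> : M%:R ^+ 2 - (M%:R ^+ 3 / (3 * B%:R) + M%:R ^+ 2 / 2) =
     M%:R ^+ 2 * (3 * B%:R - 2 * M%:R) / (6 * B%:R) :> R by field; rewrite gt_eqF.
  have Mp : 0 <= M%:R :> R by rewrite ler0n.
  have MBr : M%:R <= B%:R :> R by rewrite ler_nat.
  rewrite ger0_norm; last first.
    by rewrite divr_ge0 ?mulr_ge0 ?exprn_ge0 ?ler0n // subr_ge0; lra.
  rewrite ler_pdivrMr ?mulr_gt0 //.
  have h : M%:R * (3 * B%:R - 2 * M%:R) <= B%:R * (6 * B%:R) :> R by nra.
  by rewrite [leRHS](_ : _ = M%:R * (B%:R * (6 * B%:R))) ?expr2 -?mulrA ?ler_wpM2l //; ring.
move=> ML /= IH; rewrite (sum_trunc_rec (fun k => k%:R ^+ 2)).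
have Bn : B%:R != 0 :> R by rewrite gt_eqF.
move: IH; set s := \sum_(_ <= _ < _) _; set e := _ - _ => IH.
rewrite (_ : _ - _ = e + B%:R ^+ 2 / 6); last by rewrite /e natrD; field.
rewrite (le_trans (ler_normD _ _)) // natrD mulrDr lerD //.
by rewrite ger0_norm ?divr_ge0 ?exprn_ge0 //; nra.
Qed.

Lemma cone_sum_approx A B m : (0 < A)%N -> (0 < B)%N ->
  `| (cone_sum m A B)%:R - (m.+1%:R ^+ 3 / (6 * A%:R * B%:R)
       + m.+1%:R ^+ 2 / 4 * (A%:R^-1 - B%:R^-1)) |
  <= (A%:R + 2 * B%:R + 1) * m.+1%:R :> R.
Proof.
move=> A0 B0; set M := m.+1.
have Ap : 0 < A%:R :> R by rewrite ltr0n.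
have Bp : 0 < B%:R :> R by rewrite ltr0n.
have A1 : 1 <= A%:R :> R by rewrite ler1n.
have B1 : 1 <= B%:R :> R by rewrite ler1n.
have M1 : 1 <= M%:R :> R by rewrite ler1n.
pose x q := (M - B * q)%N.
(* Starting at p = 1 drops the term x q, which turns + x q / 2 of [sum_trunc1] into - x q / 2. *)
pose e q : R := \sum_(1 <= p < M) (x q - A * p)%:R
   - ((x q)%:R ^+ 2 / (2 * A%:R) - (x q)%:R / 2).
have eb q : `|e q| <= A%:R.
  have xM : (x q <= M)%N by rewrite leq_subr.
  have := sum_trunc1 A0 xM; rewrite /= big_ltn // muln0 subn0 => /andP[h1 h2].
  by rewrite /e ler_norml; apply/andP; split; lra.
have -> : (cone_sum m A B)%:R = \sum_(0 <= q < M) (x q)%:R ^+ 2 / (2 * A%:R)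
    - \sum_(0 <= q < M) (x q)%:R / 2 + \sum_(0 <= q < M) e q.
  rewrite /cone_sum natr_sum; under eq_bigr do rewrite natr_sum.
  rewrite exchange_big_nat -sumrB -big_split; apply: eq_bigr => q _ /=.
  rewrite /e addrC subrK; apply: eq_bigr => p _; congr (_%:R).
  by rewrite /x addnC subnDA.
rewrite -!mulr_suml.
have es : `|\sum_(0 <= q < M) e q| <= A%:R * M%:R.
  rewrite (le_trans (ler_norm_sum _ _ _)) //.
  rewrite (le_trans (ler_sum _ (fun q _ => eb q))) //.
  by rewrite sumr_const_nat subn0 mulr_natr.
move: es; set e0 := \sum_(_ <= _ < _) e _ => es.
have := sum_trunc2 B0 (leqnn M); have /= := sum_trunc1 B0 (leqnn M).
rewrite -/(x _); set s1 := \sum_(_ <= _ < _) _ => /andP[h1 h2].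
set s2 := \sum_(_ <= _ < _) _; set f2 := _ - _ => h3.
set f1 := _ - _ in h1 h2.
have -> : s2 / (2 * A%:R) - s1 / 2 + e0 -
  (M%:R ^+ 3 / (6 * A%:R * B%:R) + M%:R ^+ 2 / 4 * (A%:R^-1 - B%:R^-1)) =
  f2 / (2 * A%:R) - (M%:R / 4 + f1 / 2) + e0.
  by rewrite /f2 /f1; field; rewrite !gt_eqF.
have h4 : `|f2 / (2 * A%:R)| <= B%:R * M%:R.
  rewrite normrM normfV [`|2 * _|]ger0_norm ?mulr_ge0 ?ler0n //.
  rewrite ler_pdivrMr ?mulr_gt0 // (le_trans h3) // ler_peMr ?mulr_ge0 ?ler0n //; lra.
rewrite (le_trans (ler_normD _ _)) //.
rewrite (_ : _ * M%:R = (B%:R * M%:R + (B%:R + 1) * M%:R) + A%:R * M%:R); last by ring.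
rewrite lerD // (le_trans (ler_normB _ _)) // lerD //.
by rewrite ger0_norm; nra.
Qed.

Lemma axis_sum_approx B m : (0 < B)%N ->
  `| (axis_sum m B)%:R - m.+1%:R ^+ 2 / (2 * B%:R) | <= (B%:R + 1) * m.+1%:R :> R.
Proof.
move=> B0; have B1 : 1 <= B%:R :> R by rewrite ler1n.
have M1 : 1 <= m.+1%:R :> R by rewrite ler1n.
have /= := sum_trunc1 B0 (leqnn m.+1); rewrite -natr_sum -/(axis_sum m B).
move=> /andP[h1 h2]; rewrite ler_norml; apply/andP; split; nra.
Qed.

End PowerSums.

Section Asymptotics.
Variable R : realFieldType.

Definition linear_bounded (f : nat -> R) : Prop :=
  exists K, forall m, `|f m| <= K * m.+1%:R.

Lemma linear_boundedD f g : linear_bounded f -> linear_bounded g ->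
  linear_bounded (fun m => f m + g m).
Proof.
move=> [K1 H1] [K2 H2]; exists (K1 + K2) => m.
by rewrite (le_trans (ler_normD _ _)) // mulrDl lerD.
Qed.

Lemma linear_boundedZ c f : linear_bounded f -> linear_bounded (fun m => c * f m).
Proof.
move=> [K H]; exists (`|c| * K) => m.
by rewrite normrM -mulrA ler_wpM2l.
Qed.

Lemma linear_boundedB f g : linear_bounded f -> linear_bounded g ->
  linear_bounded (fun m => f m - g m).
Proof.
move=> Hf /(linear_boundedZ (-1))/(linear_boundedD Hf)[K H].
by exists K => m; move: (H m); rewrite mulN1r.
Qed.

Lemma linear_bounded_sum (r : seq nat) (P : pred nat) (F : nat -> nat -> R) :
  (forall i, P i -> linear_bounded (F i)) ->
  linear_bounded (fun m => \sum_(i <- r | P i) F i m).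
Proof.
move=> H; elim: r => [|i r IH].
  by exists 0 => m; rewrite big_nil normr0 mul0r.
case Pi : (P i); last by case: IH => K IH; exists K => m; rewrite big_cons Pi.
by have [K HK] := linear_boundedD (H i Pi) IH; exists K => m; rewrite big_cons Pi.
Qed.

(** The coefficients 1 / (6 A B) of all cones, doubled for the mirror images. The axis a = 0
    contributes only in order M^2. *)
Definition jump_const n : R :=
  2 * (\sum_(1 <= i < n.+1) ((6 * i%:R * i.+1%:R)^-1
          - (6 * 'C(i.+1, 2)%:R * 'C(i.+2, 2)%:R)^-1)
       + ((6 * n.+1%:R * 2)^-1 - (6 * 'C(n.+2, 2)%:R * n.+2%:R)^-1)).

Lemma natr_bin2 i : 'C(i.+1, 2)%:R = i%:R * i.+1%:R / 2 :> R.
Proof.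
apply: (mulIf (_ : 2 != 0)); first by rewrite pnatr_eq0.
by rewrite divfK ?pnatr_eq0 // -!natrM mulnC -(mul_bin_diag i.+1 1) bin1 mulnC.
Qed.

Lemma jump_sum_approx n : linear_bounded (fun m =>
  (\sum_(chi <- all_points m n) jump m n chi)%N%:R - jump_const n * m.+1%:R ^+ 3).
Proof.
pose F A B m : R := m.+1%:R ^+ 3 / (6 * A%:R * B%:R)
       + m.+1%:R ^+ 2 / 4 * (A%:R^-1 - B%:R^-1).
pose d A B m : R := (cone_sum m A B)%:R - F A B m.
pose e B m : R := (axis_sum m B)%:R - m.+1%:R ^+ 2 / (2 * B%:R).
have dP A B : (0 < A)%N -> (0 < B)%N -> linear_bounded (d A B).
  by move=> A0 B0; exists (A%:R + 2 * B%:R + 1) => m; exact: cone_sum_approx.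
have eP B : (0 < B)%N -> linear_bounded (e B).
  by move=> B0; exists (B%:R + 1) => m; exact: axis_sum_approx.
have C0 i : (0 < i)%N -> (0 < 'C(i.+1, 2))%N by move=> i0; rewrite bin_gt0.
have sumP : linear_bounded (fun m => \sum_(1 <= i < n.+1 | (0 < i)%N)
    (d i i.+1 m - d 'C(i.+1, 2) 'C(i.+2, 2) m)).
  by apply: linear_bounded_sum => i i0; apply: linear_boundedB; apply: dP; rewrite // C0.
have lastP : linear_bounded (fun m => d n.+1 2 m - d 'C(n.+2, 2) n.+2 m).
  by apply: linear_boundedB; apply: dP; rewrite // C0.
have [K HK] := linear_boundedD (linear_boundedZ 2 (linear_boundedD sumP lastP))
  (linear_boundedB (eP 2 isT) (eP n.+2 isT)).
exists K => m; move: (HK m); congr (`|_| <= _).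
have -> (G : nat -> R) : \sum_(1 <= i < n.+1 | (0 < i)%N) G i = \sum_(1 <= i < n.+1) G i.
  by rewrite big_nat_cond [RHS]big_nat; apply: eq_bigl => i; lia.
(* The M^2 terms. The right-hand side cancels against the last cone up to 1 / (n + 2) - 1 / 2, and
   twice that remainder cancels against the axis. *)
have tel : \sum_(1 <= i < n.+1) ((i%:R^-1 - i.+1%:R^-1)
    - ('C(i.+1, 2)%:R^-1 - 'C(i.+2, 2)%:R^-1)) = 'C(n.+2, 2)%:R^-1 - n.+1%:R^-1 :> R.
  pose g i : R := 'C(i.+1, 2)%:R^-1 - i%:R^-1.
  have -> : 'C(n.+2, 2)%:R^-1 - n.+1%:R^-1 = g n.+1 - g 1%N :> R.
    by rewrite /g binn !invr1 subrr subr0.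
  by rewrite -telescope_sumr //; apply: eq_bigr => i _; rewrite /g; ring.
rewrite sum_all_points /jump_const.
have -> : \sum_(1 <= i < n.+1) (d i i.+1 m - d 'C(i.+1, 2) 'C(i.+2, 2) m) =
    \sum_(1 <= i < n.+1) ((cone_sum m i i.+1)%:R - (cone_sum m 'C(i.+1, 2) 'C(i.+2, 2))%:R)
    - m.+1%:R ^+ 3 * \sum_(1 <= i < n.+1) ((6 * i%:R * i.+1%:R)^-1
          - (6 * 'C(i.+1, 2)%:R * 'C(i.+2, 2)%:R)^-1)
    - m.+1%:R ^+ 2 / 4 * ('C(n.+2, 2)%:R^-1 - n.+1%:R^-1).
  rewrite -tel !mulr_sumr -!sumrB; apply: eq_bigr => i _; rewrite /d /F; ring.
rewrite /d /F /e.
move: (\sum_(_ <= _ < _) _) (\sum_(_ <= _ < _) _) => s1 s2.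
rewrite !invfM; field.
rewrite -natrD -mulrS !pnatr_eq0.
by apply/and3P; split=> //; rewrite -lt0n C0.
Qed.

(** The terms 1 / j^2 come from the double pole of 1 / (i (i + 1)^2 (i + 2)), the product of the
    reciprocal binomials up to a constant. Induction reduces the rest to an identity of rational
    functions in n. *)
Lemma jump_constE n : jump_const n =
  4 / 3 * (\sum_(1 <= j < n.+1) (j%:R ^+ 2)^-1)
        - (12 * n%:R ^+ 4 + 65 * n%:R ^+ 3 + 117 * n%:R ^+ 2 + 72 * n%:R)
          / (6 * (n%:R + 1) ^+ 2 * (n%:R + 2) ^+ 2).
Proof.
elim: n => [|n IH].
  by rewrite /jump_const !big_geq // !natr_bin2 /=; field.
have step : jump_const n.+1 - jump_const n = 4 / 3 * (n.+1%:R ^+ 2)^-1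
  - (12 * n.+1%:R ^+ 4 + 65 * n.+1%:R ^+ 3 + 117 * n.+1%:R ^+ 2 + 72 * n.+1%:R)
          / (6 * (n.+1%:R + 1) ^+ 2 * (n.+1%:R + 2) ^+ 2)
  + (12 * n%:R ^+ 4 + 65 * n%:R ^+ 3 + 117 * n%:R ^+ 2 + 72 * n%:R)
          / (6 * (n%:R + 1) ^+ 2 * (n%:R + 2) ^+ 2).
  rewrite /jump_const [in X in X - _]big_nat_recr //= !natr_bin2.
  have n0 : 0 <= n%:R :> R by rewrite ler0n.
  move: n0; rewrite -!natr1.
  move: (\sum_(_ <= _ < _) _) (n%:R : R) => s N N0; field.
  rewrite !gt_eqF //; lra.
rewrite -[LHS](subrK (jump_const n)) step IH [in RHS]big_nat_recr //=.
by ring.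
Qed.

End Asymptotics.

(** * The cubic growth of the jump *)

Section CubicGrowth.
Variables (R : realType) (f : nat -> R) (c : R).
Hypothesis fc : linear_bounded (fun m => f m - c * m.+1%:R ^+ 3).

Lemma cubic_remainder : exists2 K, 0 <= K & forall m, (0 < m)%N ->
  `|f m - c * m%:R ^+ 3 - 3 * c * m%:R ^+ 2| <= K * m%:R.
Proof.
(* For m >= 1 one has m + 1 <= 2 m and (m + 1)^3 - m^3 - 3 m^2 = 3 m + 1 <= 4 m. *)
have [K H] := fc; exists (2 * `|K| + 4 * `|c|); first by rewrite addr_ge0 ?mulr_ge0.
move=> m m0; have m1 : 1 <= m%:R :> R by rewrite ler1n.
have -> : f m - c * m%:R ^+ 3 - 3 * c * m%:R ^+ 2 =
    (f m - c * m.+1%:R ^+ 3) + c * (3 * m%:R + 1) by rewrite -natr1; ring.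
rewrite (le_trans (ler_normD _ _)) // [leRHS]mulrDl lerD //.
  rewrite (le_trans (H m)) // -natr1; have := ler_norm K; have := normr_ge0 K.
  by nra.
by rewrite normrM [`|_ + 1|]ger0_norm; have := normr_ge0 c; nra.
Qed.

Lemma cubic_cvg : (fun m : nat => f m / m%:R ^+ 3) @ \oo --> c.
Proof.
have [K K0 H] := cubic_remainder.
apply/cvgrPdist_le => e e0; near=> m.
have m0 : (0 < m)%N by near: m; exact: nbhs_infty_gt.
have m1 : 1 <= m%:R :> R by rewrite ler1n.
have mp : 0 < m%:R :> R by rewrite ltr0n.
have me : (K + 3 * `|c|) / e <= m%:R by near: m; exact: nbhs_infty_ger.
rewrite distrC (_ : _ - c = (f m - c * m%:R ^+ 3) / m%:R ^+ 3); last first.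
  by field; rewrite gt_eqF.
rewrite normrM normfV [`|_ ^+ 3|]ger0_norm ?exprn_ge0 ?ler0n //.
rewrite ler_pdivrMr ?exprn_gt0 //.
rewrite ler_pdivrMr // in me.
have h : `|f m - c * m%:R ^+ 3| <= K * m%:R + 3 * `|c| * m%:R ^+ 2.
  rewrite -[f m - _](subrK (3 * c * m%:R ^+ 2)) (le_trans (ler_normD _ _)) //.
  by rewrite lerD ?H // normrM normrM normr_nat normrX normr_nat.
rewrite (le_trans h) //.
have h2 : K * m%:R + 3 * `|c| * m%:R ^+ 2 <= (K + 3 * `|c|) * m%:R ^+ 2.
  by rewrite [leRHS]mulrDl lerD2r expr2 mulrA ler_peMr // mulr_ge0.
rewrite (le_trans h2) // [m%:R ^+ 3]exprS [leRHS]mulrA ler_wpM2r ?exprn_ge0 // [leRHS]mulrC.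
Unshelve. all: by end_near. Qed.

Lemma cubic_bigO :
  (fun m : nat => f m - c * m%:R ^+ 3 - 3 * c * m%:R ^+ 2 : R^o)
    =O_\oo (fun m : nat => m%:R : R^o).
Proof.
have [K K0 H] := cubic_remainder.
apply/eqOP; near=> k; near=> m.
have m0 : (0 < m)%N by near: m; exact: nbhs_infty_gt.
have Kk : K <= k by near: k; exact: nbhs_pinfty_ge (num_real _).
rewrite (le_trans (H m m0)) // [`|m%:R|]ger0_norm ?ler0n //.
by rewrite ler_wpM2r.
Unshelve. all: by end_near. Qed.

End CubicGrowth.

Theorem theorem1 (R : realType) (n : nat) (hn : (1 <= n)%N) :
  (forall m : nat,
     is_hbar0 R n m (hbar0 R n m) /\
     (hbar0 R n m)%:R =
       \sum_(x \in lattice_points R n m) weight n m (int_point R x)) /\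
  [/\ (fun m : nat => (hbar0 R n m)%:R / m%:R ^+ 3 : R) @ \oo
        --> hbarOmega R n,
      hbarOmega R n =
        4 / 3 * (\sum_(1 <= j < n.+1) (j%:R ^+ 2)^-1)
        - (12 * n%:R ^+ 4 + 65 * n%:R ^+ 3 + 117 * n%:R ^+ 2 + 72 * n%:R)
          / (6 * (n%:R + 1) ^+ 2 * (n%:R + 2) ^+ 2) &
      (fun m : nat => (hbar0 R n m)%:R - hbarOmega R n * m%:R ^+ 3
                      - 3 * hbarOmega R n * m%:R ^+ 2 : R^o)
        =O_\oo (fun m : nat => m%:R : R^o)].
Proof.
have Hd m := is_hbar0_jump R hn (all_points_uniq m n) (@jump_all_points m n).
have hE m := hbar0E (Hd m).
have approx : linear_bounded (fun m => (hbar0 R n m)%:R - jump_const R n * m.+1%:R ^+ 3).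
  by have [K HK] := jump_sum_approx R n; exists K => m; rewrite hE.
have cvg_jump := cubic_cvg approx.
have limE : hbarOmega R n = jump_const R n by apply: cvg_lim cvg_jump.
split=> [m|].
  rewrite hE; split; first exact: Hd.
  exact: lattice_sum (all_points_uniq m n) (@jump_all_points m n).
rewrite limE; split; [exact: cvg_jump | exact: jump_constE | exact: cubic_bigO].
Qed.
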